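(* Let $\lambda\in(0,1)$ and let $l_\lambda$ be the spectrum of $E_\lambda$. (i) $l_\lambda=0$ if and only if $\lambda$ is irrational. (ii) $l_\lambda=\frac23$ if and only if $E_\lambda$ is totally self-similar. Furthermore, if $E_\lambda$ is not totally self-similar, then $0\le l_\lambda\le\min\{\lambda,\frac12\}$. (iii) If $\lambda$ is rational, then $l_\lambda$ is computable. In particular, if $\lambda=\frac{m\cdot 3^n}{q}$ is in lowest terms (i.e. $q$ is a positive integer and $\gcd(m\cdot 3^n,q)=1$) with $m\in\{1,2\}$ and $n$ a non-negative integer, then $l_\lambda=\frac{m}{q}$.
   Context: For $\lambda\in(0,1)$ let $\Omega_\lambda=\{0,\lambda,2\}$ and $f_d(x)=\frac{x+d}{3}$ for $d\in\Omega_\lambda$, $x\in\mathbb{R}$. $E_\lambda$ is the unique non-empty compact subset of $\mathbb{R}$ with $E_\lambda=\bigcup_{d\in\Omega_\lambda}f_d(E_\lambda)$. Its convex hull is $I=[0,1]$. $\Omega_\lambda^*=\bigcup_{n\ge 0}\Omega_\lambda^n$ is the set of all finite words over $\Omega_\lambda$, including the empty word $\epsilon$. For $\mathbf{i}=d_1\ldots d_n$ put $f_{\mathbf{i}}=f_{d_1}\circ\cdots\circ f_{d_n}$, and $f_\epsilon$ is the identity map. The set $E_\lambda$ is called totally self-similar if $f_{\mathbf{i}}(E_\lambda)=f_{\mathbf{i}}(I)\cap E_\lambda$ for every $\mathbf{i}\in\Omega_\lambda^*$. The spectrum of $E_\lambda$ is $l_\lambda=\inf A_\lambda$, where $A_\lambda$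 is the set of all nonzero values of $\left|\sum_{i=0}^{n-1}d_i 3^i\right|$ with $n\ge1$ and $d_i\in\{0,\pm\lambda,\pm(2-\lambda),\pm2\}$. Equivalently, $A_\lambda=\{3^n|f_{\mathbf{i}}(0)-f_{\mathbf{j}}(0)|:\mathbf{i},\mathbf{j}\in\Omega_\lambda^n,\ f_{\mathbf{i}}\ne f_{\mathbf{j}},\ n\ge 1\}$. ''Computable'' is meant in the following sense: there is a finite set $\Gamma$ such that every element of $A_\lambda$ is either greater than $1$ or belongs to $\Gamma$, so that (since $\lambda\in A_\lambda$ and $\lambda<1$) $l_\lambda$ is the minimum of the finite set $A_\lambda\cap(0,1]$. *)

(* Defs.v *)
From HB Require Import structures.
From mathcomp Require Import all_boot all_order all_algebra.
From mathcomp Require Import ring lra.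
From mathcomp Require Import all_classical all_reals all_analysis.

Set Implicit Arguments.
Unset Strict Implicit.
Unset Printing Implicit Defensive.

Import Order.TTheory GRing.Theory Num.Theory.
Import numFieldNormedType.Exports.

Local Open Scope classical_set_scope.
Local Open Scope ring_scope.

Definition digits (R : realType) (lambda : R) : seq R := [:: 0; lambda; 2].

Definition simil (R : realType) (d x : R) : R := (x + d) / 3.

Definition attractor (R : realType) (lambda : R) (K : set R) : Prop :=
  [/\ K !=set0, compact K &
      K = \bigcup_(d in [set` digits lambda]) (simil d @` K)].

(* [attractor_self_similar_set] and [attractor_unique] below show that the
   choice made by [get] is the only possible one. *)
Definition self_similar_set (R : realType) (lambda : R) : set R :=
  get [set K : set R | attractor lambda K].

Definition simil_word (R : realType) (w : seq R) (x : R) : R :=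
  foldr (@simil R) x w.

Definition totally_self_similar (R : realType) (lambda : R) : Prop :=
  forall w : seq R, {subset w <= digits lambda} ->
    simil_word w @` self_similar_set lambda =
    (simil_word w @` `[0, 1]) `&` self_similar_set lambda.

Definition digit_differences (R : realType) (lambda : R) : seq R :=
  [:: 0; lambda; - lambda; 2 - lambda; - (2 - lambda); 2; - 2].

Definition spectrum_set (R : realType) (lambda : R) : set R :=
  [set a | a != 0 /\
    exists (n : nat) (d : 'I_n -> R),
      [/\ (1 <= n)%N, forall i, d i \in digit_differences lambda &
          a = `| \sum_(i < n) d i * 3 ^+ i |] ].

(* [inf] is the true infimum here: for 0 < lambda the set contains lambda and is
   bounded below by 0. *)
Definition spectrum (R : realType) (lambda : R) : R := inf (spectrum_set lambda).

(* Computability of the spectrum is finiteness of the candidates up to 1: it is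
   then the least element of a finite nonempty set. *)
Definition spectrum_computable (R : realType) (lambda : R) : Prop :=
  (exists Gamma : set R, finite_set Gamma /\
     forall a, spectrum_set lambda a -> 1 < a \/ Gamma a) /\
  (let B := spectrum_set lambda `&` `]0, 1] in
   [/\ finite_set B, B (spectrum lambda) &
       forall a, B a -> spectrum lambda <= a]).

Section Attractor.
Variables (R : realType) (lambda : R).
Hypotheses (lambda_gt0 : 0 < lambda) (lambda_lt1 : lambda < 1).

Let D := [set` digits lambda].
Let H (K : set R) := \bigcup_(d in D) (simil d @` K).

Let HE K x : H K x <-> exists2 d, d \in digits lambda & K (3 * x - d).
Proof.
split=> [[d dD [y Ky <-]]|[d dD Kx]].
  by exists d => //; rewrite /simil (_ : _ - _ = y)//; field.
by exists d => //; exists (3 * x - d) => //; rewrite /simil; field.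
Qed.

Let digitsP d : d \in digits lambda -> 0 <= d <= 2.
Proof. by rewrite !inE => /or3P[] /eqP ->; apply/andP; split; move: lambda_gt0 lambda_lt1; lra. Qed.

Let level := fix level n : set R := if n is m.+1 then H (level m) else `[0, 1]%classic.

Let level_closed n : closed (level n).
Proof.
elim: n => [|n IH]; first exact: interval_closed.
have cl d : closed [set x | level n (3 * x - d)].
  apply: (@preimage_closed _ _ (fun x : R => 3 * x - d)) => // x _.
  by apply: cvgB; [apply: cvgM; [exact: cvg_cst|exact: cvg_id]|exact: cvg_cst].
rewrite [level _](_ : _ = [set x | level n (3 * x - 0)] `|`
  ([set x | level n (3 * x - lambda)] `|` [set x | level n (3 * x - 2)])).
  by do 2?apply: closedU.
apply/seteqP; split=> x.
  case/HE => d; rewrite !inE => /or3P[] /eqP -> ?;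
    by [left|right; left|right; right].
by case=> [|[]] ?; apply/HE; [exists 0|exists lambda|exists 2] => //;
  rewrite !inE eqxx ?orbT.
Qed.

Let level_dec n : level n.+1 `<=` level n.
Proof.
elim: n => [|n IH] x.
  move=> /HE[d /digitsP dP]; rewrite /= !in_itv/= => ?.
  by apply/andP; split; lra.
by move=> /HE[d dD /IH ?]; apply/HE; exists d.
Qed.

Let level_mono m n : (m <= n)%N -> level n `<=` level m.
Proof.
move=> /subnK <-; elim: (n - m)%N => [//|k IH] x; rewrite addSn.
by move=> /level_dec /IH.
Qed.

Let level0 n : level n 0.
Proof.
elim: n => [|n IH]; first by rewrite /= in_itv/= lexx ler01.
by apply/HE; exists 0; rewrite ?inE ?eqxx// mulr0 subr0.
Qed.

Lemma attractor_exists : exists K, attractor lambda K.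
Proof.
exists (\bigcap_n level n); split.
- by exists 0 => n _; exact: level0.
- apply: (@subclosed_compact R (\bigcap_n level n) `[0, 1]%classic).
  + by apply: closed_bigI => n _; exact: level_closed.
  + exact: segment_compact.
  + by move=> x /(_ 0%N I).
- apply/seteqP; split=> x.
    move=> Kx; apply/HE; apply: contrapT => nd.
    have far d : d \in digits lambda -> exists n, ~ level n (3 * x - d).
      move=> dD; apply: contrapT => nn; apply: nd; exists d => // n _.
      by apply: contrapT => ?; apply: nn; exists n.
    have [|n0 h0] := far 0; first by rewrite !inE eqxx.
    have [|n1 h1] := far lambda; first by rewrite !inE eqxx orbT.
    have [|n2 h2] := far 2; first by rewrite !inE eqxx !orbT.
    pose n := maxn n0 (maxn n1 n2).
    have /HE[d dD Ld] := Kx n.+1 I.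
    move: dD Ld; rewrite !inE => /or3P[] /eqP -> Ld.
    + by apply: h0; apply: level_mono Ld; rewrite leq_maxl.
    + by apply: h1; apply: level_mono Ld; rewrite !leq_max leqnn orbT.
    + by apply: h2; apply: level_mono Ld; rewrite !leq_max leqnn !orbT.
move=> /HE[d dD Kd] n _; apply: level_dec; apply/HE; exists d => //.
exact: Kd.
Qed.

Lemma attractor_unique K L : attractor lambda K -> attractor lambda L -> K = L.
Proof.
suff sub A B : attractor lambda A -> attractor lambda B -> A `<=` B.
  by move=> KA LA; apply/seteqP; split; exact: sub.
move=> [_ cA AE] [[b Bb] cB BE].
have /pinfty_ex_gt0[M M0 AM] := compact_bounded cA.
have /pinfty_ex_gt0[N N0 BN] := compact_bounded cB.
have approx n a : A a -> exists2 y, B y & `|a - y| <= (M + N) * 3^-1 ^+ n.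
  elim: n a => [|n IH] a Aa.
    exists b => //; rewrite expr0 mulr1 (le_trans (ler_normB _ _))//.
    by apply: lerD; [exact: AM|exact: BN].
  have : H A a by rewrite /H -AE.
  move=> [d dD [a' Aa' <-]]; have [y By ya] := IH _ Aa'.
  exists (simil d y); first by rewrite BE; exists d => //; exists y.
  rewrite /simil -mulrBl opprD addrACA subrr addr0 normrM.
  by rewrite [`|3^-1|]ger0_norm ?invr_ge0// exprSr mulrA ler_wpM2r.
move=> a Aa; have clB : closed B by exact: compact_closed (@Rhausdorff R) cB.
rewrite (closure_id B).1// => U /nbhs_ballP[e /= e0 eU].
have c0 : geometric (M + N) (3^-1 : R) @ \oo --> (0 : R).
  by apply: cvg_geometric; rewrite ger0_norm ?invr_ge0// invf_lt1// ltr1n.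
have /cvgrPdist_lt/(_ _ e0)[n _ /(_ n (leqnn n))] := c0.
rewrite /= sub0r normrN => ne; have [y By ya] := approx n a Aa.
exists y; split=> //; apply: eU; rewrite /ball/=.
by rewrite (le_lt_trans ya)// (le_lt_trans (ler_norm _)).
Qed.

Lemma attractor_self_similar_set : attractor lambda (self_similar_set lambda).
Proof. exact: (getPex attractor_exists). Qed.

End Attractor.

(* Main.v *)
Require Import Defs.
From mathcomp Require Import all_boot all_order all_algebra.
From mathcomp Require Import cyclic zify ring lra.
From mathcomp Require Import all_classical all_reals all_analysis measurable_realfun.
Import Order.TTheory GRing.Theory Num.Theory.
Import numFieldNormedType.Exports.
Local Open Scope classical_set_scope.
Local Open Scope ring_scope.

Set Implicit Arguments.
Unset Strict Implicit.
Unset Printing Implicit Defensive.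

(** Multiplying by 3 and adding a digit difference preserves the set of signed
values, so that all its small elements are found by iteration.

(iii) For rational [lambda] the signed values form a subset of a lattice
[c * int]; for [lambda = m * 3 ^ n / q] the orbit of [lambda] under
[x |-> 3 * x + d] with [d] in [{0, 2, -2}] reaches [m / q] by Euler's theorem.

(ii) If the spectrum exceeds 1/2, the orbit of [lambda] under [x |-> 3 * x - 2]
forces [lambda = 1 - 3 ^- k], and then the set of all points of [0, 1] of the
form [x + (1 - 3 ^- i)] or [x - (1 - 3 ^- i)], with [x] in the attractor and
[i <= k], is covered by its own images, hence lies in the attractor.
Conversely total self-similarity makes the attractor invariant, within [0, 1],
under translation by spectrum elements, and one below 2/3 would move the unique
longest gap.

(i) For irrational [lambda] a positive spectrum gives the attractor positive
measure, so that almost all its points are uniquely coded. As translation is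
continuous in measure, there are large patches of [lambda * int + 2 * int] all
of whose points are uniquely coded. The lowest digits tile such a patch by
L-trominoes, and such tilings are rigid: the points whose [k] lowest digits
vanish have period [3 ^ k]. A period of small positive value [th] with
[1 < 3 ^ k * th] then produces two values closer than the spectrum. *)

(** * Signed base-3 expansions and the spectrum set *)

Section Expansions.
Variables (R : realType) (lambda : R).
Implicit Types (s t : seq R) (x y a d : R).

(* Little-endian: the head of the list is the digit of weight [3 ^+ 0]. *)
Definition base3 s : R := foldr (fun d x => d + 3 * x) 0 s.

Lemma base3_sum s : base3 s = \sum_(i < size s) s`_i * 3 ^+ i.
Proof.
elim: s => [|d s IH]; first by rewrite big_ord0.
rewrite /= big_ord_recl /= expr0 mulr1 IH mulr_sumr; congr (_ + _).
by apply: eq_bigr => i _; rewrite /= /bump /= add1n exprS mulrCA.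
Qed.

(** The innermost similitude contributes the digit of weight 1, so the word of a little-endian list
    is the list read backwards. *)
Lemma simil_word_rev s x :
  simil_word (rev s) x = (x + base3 s) / 3 ^+ size s.
Proof.
elim: s x => [|d s IH] x; first by rewrite /= expr0 addr0 divr1.
rewrite rev_cons /simil_word -cats1 foldr_cat /= [LHS]IH /simil /=.
have h : 3 ^+ size s != 0 :> R by rewrite expf_neq0.
by rewrite exprS; field.
Qed.

Lemma digit_differences_sub d e : d \in digits lambda -> e \in digits lambda ->
  d - e \in digit_differences lambda.
Proof.
rewrite !inE => /or3P[] /eqP -> /or3P[] /eqP ->;
  rewrite ?subrr ?subr0 ?sub0r ?opprB ?eqxx ?orbT//.
Qed.

Lemma base3_sub s t : size s = size t ->
  {subset s <= digits lambda} -> {subset t <= digits lambda} ->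
  exists2 u, {subset u <= digit_differences lambda} & base3 u = base3 s - base3 t.
Proof.
elim: s t => [|d s IH] [|e t]//; first by exists [::] => //; rewrite /= subrr.
move=> [st] sD tD; have [||u uD uE] := IH t st.
- by move=> z zs; apply: sD; rewrite inE zs orbT.
- by move=> z zs; apply: tD; rewrite inE zs orbT.
exists (d - e :: u); last by rewrite /= uE; ring.
move=> z; rewrite inE => /predU1P[->|/uD//]; apply: digit_differences_sub.
  by apply: sD; rewrite mem_head.
by apply: tD; rewrite mem_head.
Qed.

Lemma digit_differencesP d : d \in digit_differences lambda ->
  exists e f, [/\ e \in digits lambda, f \in digits lambda & d = e - f].
Proof.
have h0 : 0 \in digits lambda by rewrite !inE eqxx.
have hl : lambda \in digits lambda by rewrite !inE eqxx orbT.
have h2 : 2 \in digits lambda by rewrite !inE eqxx !orbT.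
rewrite !inE => /or4P[/eqP ->|/eqP ->|/eqP ->|/or4P[] /eqP ->].
- by exists 0, 0; rewrite subrr.
- by exists lambda, 0; rewrite subr0.
- by exists 0, lambda; rewrite sub0r.
- by exists 2, lambda.
- by exists lambda, 2; rewrite opprB.
- by exists 2, 0; rewrite subr0.
- by exists 0, 2; rewrite sub0r.
Qed.

(** Unlike [spectrum_set], this keeps signs and admits 0 through the empty list, so that it is
    closed under [3 * x + d]. *)
Definition signed_value x :=
  exists2 u, {subset u <= digit_differences lambda} & x = base3 u.

Lemma signed_value0 : signed_value 0.
Proof. by exists [::]. Qed.

Lemma signed_value_step x d : d \in digit_differences lambda ->
  signed_value x -> signed_value (3 * x + d).
Proof.
move=> dD [u uD ->]; exists (d :: u); last by rewrite /= addrC.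
by move=> z; rewrite inE => /predU1P[->|/uD].
Qed.

Lemma signed_valueP x : signed_value x -> exists s t,
  [/\ size s = size t, {subset s <= digits lambda}, {subset t <= digits lambda} &
      x = base3 s - base3 t].
Proof.
move=> [u uD ->]; elim: u uD => [|d u IH] uD.
  by exists [::], [::]; split=> //; rewrite /= subrr.
have [|s [t [st sD tD E]]] := IH; first by move=> z zu; apply: uD; rewrite inE zu orbT.
have /digit_differencesP[e [f [eD fD dE]]] : d \in digit_differences lambda.
  by apply: uD; rewrite mem_head.
exists (e :: s), (f :: t); split=> /=; first by rewrite st.
- by move=> z; rewrite inE => /predU1P[->|/sD].
- by move=> z; rewrite inE => /predU1P[->|/tD].
- by rewrite E dE; ring.
Qed.

Lemma signed_valueN x : signed_value x -> signed_value (- x).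
Proof.
move=> /signed_valueP[s [t [st sD tD ->]]]; rewrite opprB.
by have [u uD <-] := base3_sub (esym st) tD sD; exists u.
Qed.

Lemma spectrum_setP a :
  spectrum_set lambda a <-> [/\ 0 < a & signed_value a].
Proof.
split=> [[a0 [n [d [n1 dD aE]]]]|[a0 [u uD aE]]].
  split; first by rewrite lt0r a0 aE normr_ge0.
  have h : signed_value (\sum_(i < n) d i * 3 ^+ i).
    exists [seq d i | i <- enum 'I_n].
      by move=> z /mapP[i _ ->].
    rewrite base3_sum size_map size_enum_ord; apply: eq_bigr => i _.
    by rewrite (nth_map i) ?size_enum_ord// nth_ord_enum.
  by rewrite aE; case: (ger0P (\sum_(i < n) d i * 3 ^+ i)) => // _;
    exact: signed_valueN.
split; first by rewrite gt_eqF.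
exists (size u), (fun i => u`_i); split.
- by rewrite lt0n size_eq0; apply/eqP => u0; move: a0; rewrite aE u0 ltxx.
- by move=> i; apply: uD; rewrite mem_nth.
- by rewrite -base3_sum -aE gtr0_norm.
Qed.

Lemma spectrum_set_abs x : signed_value x -> x != 0 -> spectrum_set lambda `|x|.
Proof.
move=> Px x0; apply/spectrum_setP; rewrite normr_gt0; split=> //.
by case: (ger0P x) => // _; exact: signed_valueN.
Qed.

Lemma signed_value_lambda : signed_value lambda.
Proof.
rewrite -[lambda]add0r -{1}[0](mulr0 3); apply: signed_value_step => //.
  by rewrite !inE eqxx orbT.
exact: signed_value0.
Qed.

Lemma spectrum_set_lambda : 0 < lambda -> spectrum_set lambda lambda.
Proof. by move=> l0; apply/spectrum_setP; split=> //; exact: signed_value_lambda. Qed.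

Lemma spectrum_has_lbound : has_lbound (spectrum_set lambda).
Proof. by exists 0 => a /spectrum_setP[/ltW]. Qed.

Lemma spectrum_le a : spectrum_set lambda a -> spectrum lambda <= a.
Proof. by move=> Aa; apply: ge_inf => //; exact: spectrum_has_lbound. Qed.

Lemma le_spectrum b : 0 < lambda ->
  (forall a, spectrum_set lambda a -> b <= a) -> b <= spectrum lambda.
Proof.
move=> l0 h; apply: lb_le_inf => //.
by exists lambda; exact: spectrum_set_lambda.
Qed.

Lemma spectrum_ge0 : 0 < lambda -> 0 <= spectrum lambda.
Proof. by move=> l0; apply: le_spectrum => // a /spectrum_setP[/ltW]. Qed.

(** Every digit difference is an integer combination of [lambda] and 2, so a common unit [c] of
    these two divides all signed values. *)
Lemma signed_value_int (c : R) :
  (exists i : int, lambda = i%:~R * c) -> (exists i : int, 2 = i%:~R * c) ->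
  forall x, signed_value x -> exists i : int, x = i%:~R * c.
Proof.
move=> [i lE] [j twoE] x [u uD ->].
elim: u uD => [|d u IH] uD; first by exists 0; rewrite mul0r.
have [|k kE] := IH; first by move=> z zu; apply: uD; rewrite inE zu orbT.
have [m dE] : exists m : int, d = m%:~R * c.
  have : d \in digit_differences lambda by apply: uD; rewrite mem_head.
  rewrite !inE => /or4P[/eqP ->|/eqP ->|/eqP ->|/or4P[] /eqP ->].
  - by exists 0; rewrite mul0r.
  - by exists i.
  - by exists (- i); rewrite rmorphN mulNr -lE.
  - by exists (j - i); rewrite rmorphB mulrBl -lE -twoE.
  - by exists (i - j); rewrite rmorphB mulrBl -lE -twoE opprB.
  - by exists j.
  - by exists (- j); rewrite rmorphN mulNr -twoE.
by exists (m + 3 * k); rewrite /= kE dE rmorphD rmorphM /=; ring.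
Qed.

Lemma spectrum_set_nat (c : R) : 0 < c ->
  (exists i : int, lambda = i%:~R * c) -> (exists i : int, 2 = i%:~R * c) ->
  forall a, spectrum_set lambda a -> exists2 k : nat, (0 < k)%N & a = k%:R * c.
Proof.
move=> c0 lE twoE a /spectrum_setP[a0 /(signed_value_int lE twoE)[i aE]].
move: a0; rewrite aE pmulr_lgt0// ltr0z => i0.
by exists `|i|%N; rewrite ?absz_gt0 ?gt_eqF// natr_absz gtr0_norm.
Qed.

Lemma spectrum_ge_unit (c : R) : 0 < lambda -> 0 < c ->
  (exists i : int, lambda = i%:~R * c) -> (exists i : int, 2 = i%:~R * c) ->
  c <= spectrum lambda.
Proof.
move=> l0 c0 lE twoE; apply: le_spectrum => // a.
move=> /(spectrum_set_nat c0 lE twoE)[k k0 ->].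
by rewrite ler_peMl ?(ltW c0)// ler1n.
Qed.

End Expansions.

(** * Rational parameters: computability and explicit values *)

Section RationalParameter.
Variables (R : realType) (lambda : R).
Hypotheses (lambda_gt0 : 0 < lambda) (lambda_lt1 : lambda < 1).

Lemma rational_unit : rational lambda -> exists2 c : R, 0 < c &
  (exists i : int, lambda = i%:~R * c) /\ (exists i : int, 2 = i%:~R * c).
Proof.
move=> /rationalP[a [b lE]].
have b0 : (0 < b)%N.
  by rewrite lt0n; apply/eqP => b0; move: lambda_gt0; rewrite lE b0 invr0 mulr0 ltxx.
exists (b%:R^-1); first by rewrite invr_gt0 ltr0n.
split; first by exists a.
exists (2 * b%:Z); rewrite rmorphM /= -mulrA mulfV ?mulr1//.
by rewrite pnatr_eq0 -lt0n.
Qed.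

Lemma rational_spectrum_gt0 : rational lambda -> 0 < spectrum lambda.
Proof.
by move=> /rational_unit[c c0 [h1 h2]]; rewrite (lt_le_trans c0)// spectrum_ge_unit.
Qed.

Lemma rational_computable : rational lambda -> spectrum_computable lambda.
Proof.
move=> lQ; have [c c0 [h1 h2]] := rational_unit lQ.
have An := spectrum_set_nat c0 h1 h2.
pose B := spectrum_set lambda `&` `]0, 1].
have finB : finite_set B.
  apply: (@sub_finite_set _ _ [set k%:R * c | k in `I_(Num.bound c^-1)]);
    last exact: finite_image.
  move=> a [/An[k k0 ->]]; rewrite /= in_itv /= => /andP[_ k1].
  exists k => //=; rewrite -(ltr_nat R).
  have : k%:R <= c^-1 by rewrite -[c^-1]mul1r ler_pdivlMr.
  by move=> /le_lt_trans; apply; apply: archi_boundP; rewrite invr_ge0 ltW.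
(* All candidates are natural multiples of [c], so the infimum is attained at the least admissible
   multiplier. *)
have ex : exists k, (fun k : nat => `[< spectrum_set lambda (k%:R * c) >]) k.
  have [k _ kE] := An _ (spectrum_set_lambda lambda_gt0).
  by exists k; apply/asboolP; rewrite -kE; exact: spectrum_set_lambda.
case: (ex_minnP ex) => k /asboolP Ak kmin.
have sE : spectrum lambda = k%:R * c.
  apply/eqP; rewrite eq_le spectrum_le//= le_spectrum// => a Aa.
  have [j _ aE] := An _ Aa; rewrite aE ler_pM2r// ler_nat kmin//.
  by apply/asboolP; rewrite -aE.
split.
  exists B; split=> // a Aa; have [a1|a1] := ltP 1 a; [by left|right].
  by split=> //=; rewrite in_itv /= a1 andbT; case/spectrum_setP : Aa.
split=> //; last by move=> a [/spectrum_le].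
split; first by rewrite sE.
rewrite /= in_itv /= rational_spectrum_gt0//=.
by rewrite (le_trans (spectrum_le (spectrum_set_lambda lambda_gt0)))// ltW//.
Qed.

(* The digits 0 and 2, -2 suffice to multiply by 3 modulo 2 inside [-1, 1]. *)
Lemma signed_value_triple j : exists2 y : R, signed_value lambda y &
  `|y| <= 1 /\ exists k : int, y = 3 ^+ j * lambda - 2 * k%:~R.
Proof.
elim: j => [|j [y Py [y1 [k yE]]]].
  exists lambda; first exact: signed_value_lambda.
  by split; [rewrite gtr0_norm// ltW|exists 0; rewrite expr0; ring].
have P3 i : 2 * i%:~R \in digit_differences lambda -> `|3 * y + 2 * i%:~R| <= 1 ->
  exists2 y, signed_value lambda y &
  `|y| <= 1 /\ exists k : int, y = 3 ^+ j.+1 * lambda - 2 * k%:~R.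
  move=> iD h; exists (3 * y + 2 * i%:~R); first exact: signed_value_step.
  split=> //; exists (3 * k - i); rewrite yE exprS rmorphB rmorphM /=; ring.
move: y1; rewrite ler_norml => /andP[y1 y2].
have [h|h] := ltP 1 (3 * y).
  apply: (P3 (- 1)); first by rewrite !inE rmorphN mulrN mulr1 eqxx !orbT.
  by rewrite ler_norml rmorphN /=; apply/andP; split; lra.
have [h'|h'] := ltP (3 * y) (- 1).
  apply: (P3 1); first by rewrite !inE mulr1 eqxx !orbT.
  by rewrite ler_norml /=; apply/andP; split; lra.
apply: (P3 0); first by rewrite !inE mulr0 eqxx.
by rewrite ler_norml /=; apply/andP; split; lra.
Qed.

(** With [c = m / q], both [lambda = 3 ^+ n * c] and 2 are multiples of [c], which bounds the
    spectrum below. Conversely [c] itself is reached by tripling [lambda] modulo 2 until the power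
    of 3 returns to 1 modulo [Q]. *)
Lemma spectrum_rational_value (m n q : nat) :
  m = 1%N \/ m = 2%N -> (0 < q)%N -> coprime (m * 3 ^ n) q ->
  lambda = (m * 3 ^ n)%:R / q%:R -> spectrum lambda = m%:R / q%:R.
Proof.
move=> m12 q0 cop lE.
have m0 : (0 < m)%N by case: m12 => ->.
have qR : 0 < q%:R :> R by rewrite ltr0n.
have mR : 0 < m%:R :> R by rewrite ltr0n.
pose c : R := m%:R / q%:R.
have c0 : 0 < c by rewrite divr_gt0.
have lE' : lambda = 3 ^+ n * c by rewrite lE /c natrM natrX; ring.
(* [Q] is [2 / c], so congruences modulo [Q] become congruences of multiples of [c] modulo 2. *)
pose Q := if m == 1%N then (2 * q)%N else q.
have mQ : (m * Q = 2 * q)%N by rewrite /Q; case: m12 => ->; rewrite ?mul1n.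
have QE : Q%:R * c = 2 :> R.
  have /(congr1 (fun k => k%:R : R)) := mQ; rewrite !natrM => mQR.
  by rewrite /c mulrA (mulrC Q%:R) mQR mulfK// gt_eqF.
apply/eqP; rewrite eq_le; apply/andP; split; last first.
  apply: spectrum_ge_unit => //.
    by exists (3 ^ n)%N; rewrite lE' -pmulrn natrX.
  by exists Q; rewrite -pmulrn QE.
apply: spectrum_le.
have [t tE] : exists t : nat, (3 ^ (totient Q * n) = 1 + Q * t)%N.
  have [->|n0] := posnP n; first by exists 0%N; rewrite !muln0 expn0.
  have c3 : coprime 3 Q.
    move: cop; rewrite coprimeMl coprime_pexpl// => /andP[_ c3].
    by rewrite /Q; case: ifP => // _; rewrite coprimeMr.
  have h : 3 ^ (totient Q * n) = 1 %[mod Q].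
    by rewrite expnM -modnXm (Euler_exp_totient c3) modnXm exp1n.
  move/eqP: h; rewrite eqn_mod_dvd ?expn_gt0// => /dvdnP[t tE].
  by exists t; rewrite (mulnC Q) -tE subnKC ?expn_gt0.
have tot0 : (0 < totient Q)%N.
  by rewrite totient_gt0 /Q; case: ifP => // _; rewrite muln_gt0.
(* The factor [3 ^+ n] of [lambda] accounts for the missing [n] triplings: the total power is
   [3 ^ (totient Q * n) = 1 + Q * t]. *)
have [y Py [y1 [k yE]]] := signed_value_triple (totient Q * n - n).
have {}yE : y = c + 2 * (t%:Z - k)%:~R.
  rewrite yE lE' mulrA -exprD subnK ?leq_pmull//.
  have -> : 3 ^+ (totient Q * n) = 1 + Q%:R * t%:R :> R.
    by rewrite -natrX tE natrD natrM.
  rewrite rmorphB /= -!pmulrn; have := QE; set u := Q%:R.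
  by move=> <-; ring.
have c1 : c < 1.
  by rewrite (le_lt_trans _ lambda_lt1)// lE' ler_peMl ?(ltW c0)// exprn_ege1// ler1n.
(* [y] and [c] agree modulo 2; as [|y| <= 1] and [0 < c < 1], they are equal. *)
suff z0 : (t%:Z - k)%R = 0.
  have yc : y = c by rewrite yE z0 mulr0z mulr0 addr0.
  by apply/spectrum_setP; split=> //; rewrite -/c -yc.
move: y1; rewrite yE ler_norml => /andP[y1 y2].
have z1 : ((t%:Z - k)%:~R : R) < 1 by move: c0 c1 y2; lra.
have z2 : (-1 : R) < (t%:Z - k)%:~R by move: c0 c1 y1; lra.
move: z1 z2; rewrite -(rmorphN1 (intmul 1)) ltr_int ltrz1.
by lia.
Qed.

End RationalParameter.

(** * The attractor, its gaps, and total self-similarity *)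

Section SelfSimilarSet.
Variables (R : realType) (lambda : R).
Hypotheses (lambda_gt0 : 0 < lambda) (lambda_lt1 : lambda < 1).
Implicit Types (K : set R) (x y z u v : R) (w : seq R).

Local Notation E := (self_similar_set lambda).

Let attractorE : attractor lambda E.
Proof. exact: attractor_self_similar_set. Qed.

Lemma self_similar_compact : compact E.
Proof. by have [] := attractorE. Qed.

Lemma self_similarP x : E x <-> exists2 d, d \in digits lambda & E (3 * x - d).
Proof.
have [_ _ EE] := attractorE; split=> [|[d dD Ex]].
  rewrite {1}EE => -[d dD [y Ey <-]]; exists d => //.
  by rewrite /simil (_ : _ - _ = y)//; field.
rewrite EE; exists d => //; exists (3 * x - d) => //.
by rewrite /simil; field.
Qed.

Lemma self_similar_simil d x : d \in digits lambda -> E x -> E (simil d x).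
Proof.
move=> dD Ex; apply/self_similarP; exists d => //.
by rewrite /simil (_ : _ - _ = x)//; field.
Qed.

Lemma self_similar_word w x : {subset w <= digits lambda} -> E x ->
  E (simil_word w x).
Proof.
elim: w => [//|d w IH] wD Ex /=; apply: self_similar_simil.
  by apply: wD; rewrite mem_head.
by apply: IH => // z zw; apply: wD; rewrite inE zw orbT.
Qed.

(* Coinduction principle: [E] is the largest bounded set covered by its own
   images. *)
Lemma self_similar_coind K : (exists M, forall x, K x -> `|x| <= M) ->
  (forall x, K x -> exists2 d, d \in digits lambda & K (3 * x - d)) -> K `<=` E.
Proof.
move=> [M KM] KE a Ka.
have [[b Eb] cE _] := attractorE.
have /pinfty_ex_gt0[N N0 EN] := compact_bounded cE.
have approx n x : K x -> exists2 y, E y & `|x - y| <= (M + N) * 3^-1 ^+ n.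
  elim: n x => [|n IH] x Kx.
    exists b => //; rewrite expr0 mulr1 (le_trans (ler_normB _ _))//.
    by apply: lerD; [exact: KM|exact: EN].
  have [d dD /IH[y Ey xy]] := KE x Kx.
  exists (simil d y); first exact: self_similar_simil.
  have -> : x - simil d y = (3 * x - d - y) / 3 by rewrite /simil; field.
  by rewrite normrM [`|3^-1|]ger0_norm ?invr_ge0// exprSr mulrA ler_wpM2r.
have clE : closed E by exact: compact_closed (@Rhausdorff R) cE.
rewrite (closure_id E).1// => U /nbhs_ballP[e /= e0 eU].
have c0 : geometric (M + N) (3^-1 : R) @ \oo --> (0 : R).
  by apply: cvg_geometric; rewrite ger0_norm ?invr_ge0// invf_lt1// ltr1n.
have /cvgrPdist_lt/(_ _ e0)[n _ /(_ n (leqnn n))] := c0.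
rewrite /= sub0r normrN => ne; have [y Ey ya] := approx n a Ka.
exists y; split=> //; apply: eU; rewrite /ball/=.
by rewrite (le_lt_trans ya)// (le_lt_trans (ler_norm _)).
Qed.

Lemma digits_itv d : d \in digits lambda -> 0 <= d <= 2.
Proof.
by rewrite !inE => /or3P[] /eqP ->; apply/andP; split;
  move: lambda_gt0 lambda_lt1; lra.
Qed.

Lemma mem_digit0 : 0 \in digits lambda. Proof. by rewrite !inE eqxx. Qed.
Lemma mem_digit1 : lambda \in digits lambda. Proof. by rewrite !inE eqxx orbT. Qed.
Lemma mem_digit2 : 2 \in digits lambda. Proof. by rewrite !inE eqxx !orbT. Qed.

(** Since digits lie in [0, 2], expanding a point outside [0, 1] at least triples its distance
    beyond the endpoint, which contradicts boundedness. *)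
Lemma self_similar_itv x : E x -> 0 <= x <= 1.
Proof.
have /pinfty_ex_gt0[M M0 EM] := compact_bounded self_similar_compact.
have expand n y : E y -> 3 ^+ n * (y - 1) <= M + 1 /\ 3 ^+ n * (- y) <= M + 1.
  elim: n y => [|n IH] y Ey.
    have := EM _ Ey; rewrite /= ler_norml => /andP[? ?].
    by rewrite expr0; split; lra.
  have [d /digits_itv/andP[d0 d2] /IH[h1 h2]] := (self_similarP y).1 Ey.
  have p : 0 <= 3 ^+ n :> R by rewrite exprn_ge0.
  rewrite exprSr; split.
    by apply: le_trans h1; rewrite -mulrA ler_wpM2l//; lra.
  by apply: le_trans h2; rewrite -mulrA ler_wpM2l//; lra.
have small y : (forall n, 3 ^+ n * y <= M + 1) -> y <= 0.
  move=> h; rewrite leNgt; apply/negP => y0.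
  have M1 : 0 <= (M + 1) / y by rewrite divr_ge0 ?ltW// ltr_wpDr.
  have := archi_boundP M1; set n := Num.bound _ => hn.
  have h3 : n%:R <= 3 ^+ n :> R by rewrite -natrX ler_nat ltnW// ltn_expl.
  have := h n; rewrite leNgt => /negP; apply.
  by rewrite -ltr_pdivrMr// (lt_le_trans hn).
move=> Ex; apply/andP; split.
  by rewrite -oppr_le0; apply: small => n; have [] := expand n x Ex.
by rewrite -subr_le0; apply: small => n; have [] := expand n x Ex.
Qed.

Lemma self_similar0 : E 0.
Proof.
apply: (@self_similar_coind [set 0]) => //.
  by exists 0 => x /= ->; rewrite normr0.
by move=> x /= ->; exists 0; rewrite ?mem_digit0// mulr0 subr0.
Qed.

Lemma self_similar1 : E 1.
Proof.
apply: (@self_similar_coind [set 1]) => //.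
  by exists 1 => x /= ->; rewrite normr1.
by move=> x /= ->; exists 2; rewrite ?mem_digit2//=; ring.
Qed.

Lemma self_similar_central_gap x : E x -> x <= (1 + lambda) / 3 \/ 2 / 3 <= x.
Proof.
move=> /self_similarP[d dD /self_similar_itv/andP[h1 h2]].
move: dD; rewrite !inE => /or3P[] /eqP dE; subst d; [left|left|right];
  move: lambda_gt0 lambda_lt1; lra.
Qed.

Definition gap u v := [/\ 0 <= u, u < v, v <= 1 & forall x, u < x < v -> ~ E x].

Lemma gap_avoid u v x : gap u v -> E x -> x <= u \/ v <= x.
Proof.
move=> [_ _ _ h] Ex; have [ux|xu] := ltP u x; last by left.
by have [xv|] := ltP x v; [exfalso; apply: (h x); rewrite ?ux|right].
Qed.

Lemma gap_scale d u v : d \in digits lambda -> gap u v ->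
  0 <= 3 * u - d -> 3 * v - d <= 1 -> gap (3 * u - d) (3 * v - d).
Proof.
move=> dD [_ uv _ h] u0 v1; split=> //; first by lra.
move=> x /andP[ux xv] /(self_similar_simil dD); apply: h.
by rewrite /simil; apply/andP; split; lra.
Qed.

(** The points 1/3, [(1 + lambda) / 3] and 2/3 lie in [E] and cannot be inside a gap. A gap off the
    central one therefore lies in one of the three copies of [0, 1], where it can be magnified. *)
Lemma gap_dichotomy u v : gap u v ->
  ((1 + lambda) / 3 <= u /\ v <= 2 / 3) \/
  exists u' v', gap u' v' /\ v' - u' = 3 * (v - u).
Proof.
move=> g; have [u0 uv v1 _] := g.
have E1 : E (1 / 3).
  by have := self_similar_simil mem_digit0 self_similar1; rewrite /simil addr0.
have E2 := self_similar_simil mem_digit1 self_similar1.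
have E3 : E (2 / 3).
  by have := self_similar_simil mem_digit2 self_similar0; rewrite /simil add0r.
have big d : d \in digits lambda -> 0 <= 3 * u - d -> 3 * v - d <= 1 ->
    exists u' v', gap u' v' /\ v' - u' = 3 * (v - u).
  move=> dD hu hv; exists (3 * u - d), (3 * v - d); split; last by ring.
  exact: gap_scale.
have [h1|h1] := gap_avoid g E1; last first.
  by right; apply: (big 0); rewrite ?mem_digit0//; lra.
have [h2|h2] := gap_avoid g E2; rewrite /simil in h2; last first.
  by right; apply: (big lambda); rewrite ?mem_digit1//; move: lambda_lt1; lra.
have [h3|h3] := gap_avoid g E3; last by left.
by right; apply: (big 2); rewrite ?mem_digit2//; lra.
Qed.

(** Magnification must end, in the central gap, before the length exceeds 1; the induction is on a
    number [n] of triplings that would exceed it. *)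
Lemma gap_length u v : gap u v -> v - u <= (1 - lambda) / 3.
Proof.
move=> g; have [u0 uv v1 _] := g.
suff main n u' v' : gap u' v' -> 1 < 3 ^+ n * (v' - u') ->
    v' - u' <= (1 - lambda) / 3.
  have d0 : 0 < v - u by rewrite subr_gt0.
  have := archi_boundP (ltW (etrans (invr_gt0 _) d0)).
  set n := Num.bound _ => hn; apply: (main n) => //.
  rewrite -ltr_pdivrMr// div1r (lt_le_trans hn)//.
  by rewrite -natrX ler_nat ltnW// ltn_expl.
elim: n u' v' => [|n IH] {u v g u0 uv v1} u v g; have [u0 uv v1 _] := g.
  by rewrite expr0 mul1r; lra.
rewrite exprSr -mulrA; have [[h1 h2] _|[u' [v' [g' E']]]] := gap_dichotomy g.
  by move: h1 h2; lra.
by rewrite -E' => /(IH _ _ g'); rewrite E'; move: uv; lra.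
Qed.

(** Elsewhere such a gap could be magnified beyond the bound of [gap_length]. *)
Lemma longest_gap_unique u v : gap u v -> (1 - lambda) / 3 <= v - u ->
  u = (1 + lambda) / 3.
Proof.
move=> g l; have [u0 uv v1 _] := g.
have [[h1 h2]|[u' [v' [g' E']]]] := gap_dichotomy g.
  by apply/eqP; rewrite eq_le h1 andbT; move: h2 l; lra.
by have := gap_length g'; rewrite E'; move: l uv lambda_lt1; lra.
Qed.

(** With [x = base3 s - base3 t], the words of [s] and [t] send [y] and [y + x] to the same point of
    [E]. Total self-similarity along [t] gives that point a preimage in [E], which is [y + x] by
    injectivity. *)
Lemma tss_translate : totally_self_similar lambda ->
  forall x y, signed_value lambda x -> E y -> 0 <= y + x <= 1 -> E (y + x).
Proof.
move=> tss x y /signed_valueP[s [t [st sD tD ->]]] Ey yx.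
have rsD : {subset rev s <= digits lambda} by move=> z; rewrite mem_rev => /sD.
have rtD : {subset rev t <= digits lambda} by move=> z; rewrite mem_rev => /tD.
have : (simil_word (rev t) @` `[0, 1] `&` E) (simil_word (rev s) y).
  split; last exact: self_similar_word.
  exists (y + (base3 s - base3 t)); first by rewrite /= in_itv.
  by rewrite !simil_word_rev st; congr (_ / _); ring.
rewrite -tss// => -[z Ez]; rewrite !simil_word_rev st => /(congr1 ( *%R^~ (3 ^+ size t))).
rewrite !divfK ?expf_neq0// => zE.
suff -> : y + (base3 s - base3 t) = z by [].
by rewrite addrA -zE addrK.
Qed.

(* A translation in [spectrum_set] would move the longest gap or land in it. *)
Lemma tss_spectrum_set a : totally_self_similar lambda ->
  spectrum_set lambda a -> 2 / 3 <= a.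
Proof.
move=> tss /spectrum_setP[a0 Pa]; rewrite leNgt; apply/negP => a23.
have [al|al] := leP a ((1 + lambda) / 3); last first.
  have Ea : E a.
    rewrite -[a]add0r; apply: tss_translate => //; first exact: self_similar0.
    by apply/andP; split; lra.
  by have [] := self_similar_central_gap Ea; lra.
have g : gap ((1 + lambda) / 3 - a) (2 / 3 - a).
  split; [by lra|by move: lambda_lt1; lra|by lra|].
  move=> x /andP[x1 x2] Ex.
  have : E (x + a).
    apply: tss_translate => //.
    by apply/andP; split; move: lambda_gt0; lra.
  by move=> /self_similar_central_gap; lra.
by have := longest_gap_unique g; lra.
Qed.

(** The map [3 * x - 2] fixes 1 and triples the distance to it; this is the orbit of [lambda]. *)
Lemma signed_value_orbit k : signed_value lambda (1 - 3 ^+ k * (1 - lambda)).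
Proof.
elim: k => [|k IH].
  by rewrite expr0 mul1r opprB addrC subrK; exact: signed_value_lambda.
rewrite (_ : 1 - _ = 3 * (1 - 3 ^+ k * (1 - lambda)) + - 2); last first.
  by rewrite exprS; ring.
by apply: signed_value_step => //; rewrite !inE eqxx !orbT.
Qed.

(** Take the first orbit point whose distance to 1 exceeds 1/3. That distance is at most 1; it
    equals 1 in the first case, and otherwise the point itself is in (0, 2/3). *)
Lemma signed_value_lt23 :
  (exists2 k, (0 < k)%N & lambda = 1 - 3^-1 ^+ k) \/
  exists2 x, signed_value lambda x & 0 < x < 2 / 3.
Proof.
have ex : exists k, 1 / 3 < 3 ^+ k * (1 - lambda).
  have l0 : 0 < 1 - lambda by rewrite subr_gt0.
  have := archi_boundP (ltW (etrans (invr_gt0 _) l0)).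
  set n := Num.bound _ => hn; exists n; rewrite -ltr_pdivrMr//.
  have h3 : n%:R <= 3 ^+ n :> R by rewrite -natrX ler_nat ltnW// ltn_expl.
  by apply: lt_le_trans h3; rewrite (le_lt_trans _ hn)// ler_piMl ?invr_ge0 ?ltW//; lra.
case: (ex_minnP ex) => k hk kmin.
have hk1 : 3 ^+ k * (1 - lambda) <= 1.
  case: k hk kmin => [|k] hk kmin; first by rewrite expr0; move: lambda_gt0; lra.
  rewrite exprS -mulrA; have : ~~ (1 / 3 < 3 ^+ k * (1 - lambda)).
    by apply/negP => /kmin; rewrite ltnn.
  by rewrite -leNgt; lra.
have [kE|kN] := eqVneq (3 ^+ k * (1 - lambda)) 1; last first.
  right; exists (1 - 3 ^+ k * (1 - lambda)); first exact: signed_value_orbit.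
  by rewrite subr_gt0 lt_neqAle kN hk1/=; move: hk; lra.
left; exists k.
  by case: k kE {hk hk1 kmin} => //; rewrite expr0; move: lambda_gt0; lra.
have h3 : 3 ^+ k != 0 :> R by rewrite expf_neq0.
have -> : 3^-1 ^+ k = 1 - lambda by apply: (mulfI h3); rewrite exprVn mulfV// kE.
by rewrite subKr.
Qed.

(** 2/3 is the last orbit point before the orbit hits 0. *)
Lemma spectrum_set_23 k : (0 < k)%N -> lambda = 1 - 3^-1 ^+ k ->
  spectrum_set lambda (2 / 3).
Proof.
case: k => // k _ lE; apply/spectrum_setP; split; first by lra.
have := signed_value_orbit k.
have -> : 1 - lambda = 3^-1 ^+ k.+1 by rewrite lE subKr.
have -> : 3 ^+ k * 3^-1 ^+ k.+1 = 3^-1 :> R.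
  by rewrite exprSr mulrA -exprMn divff// expr1n mul1r.
by rewrite (_ : 1 - 3^-1 = 2 / 3 :> R)//; field.
Qed.

Lemma tss_spectrum : totally_self_similar lambda -> spectrum lambda = 2 / 3.
Proof.
move=> tss; have ge := fun a => tss_spectrum_set tss (a := a).
apply/eqP; rewrite eq_le le_spectrum// andbT.
have [[k k0 lE]|[x Px /andP[x0 x23]]] := signed_value_lt23.
  exact/spectrum_le/spectrum_set_23/lE.
have : spectrum_set lambda x by apply/spectrum_setP.
by move=> /ge; rewrite leNgt x23.
Qed.

(* If an element [x] of the spectrum set lies in [(1/2, 2/3)], then
   [2 - 3 * x] is a smaller one. *)
Lemma spectrum_gt12 : 1 / 2 < spectrum lambda ->
  exists2 k, (0 < k)%N & lambda = 1 - 3^-1 ^+ k.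
Proof.
move=> l12; have [//|[x Px /andP[x0 x23]]] := signed_value_lt23.
have Ax : spectrum_set lambda x by apply/spectrum_setP.
have x12 := lt_le_trans l12 (spectrum_le Ax).
have Py : signed_value lambda (3 * x + - 2).
  by apply: signed_value_step => //; rewrite !inE eqxx !orbT.
have y0 : 3 * x + - 2 < 0 by lra.
have := spectrum_set_abs Py (ltr0_neq0 y0).
by rewrite ltr0_norm// => /spectrum_le; move: l12 x12; lra.
Qed.

(** Coinduction on the shifts of [E] by [1 - 3 ^- i]. As three times [1 - 3 ^- (i + 1)] is
    [2 + (1 - 3 ^- i)], one expansion absorbs the 2 into the digit and lowers the index. Only an
    upward shift of a point with digit [lambda] differs: it occurs at index 1 alone, and leaves the
    shift [lambda], of index [k]. *)
Lemma self_similar_shift k x : (0 < k)%N -> lambda = 1 - 3^-1 ^+ k -> E x ->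
  (0 <= x + lambda <= 1 -> E (x + lambda)) /\
  (0 <= x - lambda <= 1 -> E (x - lambda)).
Proof.
move=> k0 lE Ex.
pose K := [set z : R | 0 <= z <= 1 /\ exists y i, [/\ E y, (i <= k)%N &
  z = y + (1 - 3^-1 ^+ i) \/ z = y - (1 - 3^-1 ^+ i)]].
suff KE : K `<=` E.
  by split=> h; apply: KE; split=> //; exists x, k; split=> //;
    rewrite -lE; [left|right].
have e01 i : 0 < (3^-1 : R) ^+ i <= 1.
  by rewrite exprn_gt0 ?invr_gt0//= exprn_ile1// ?invr_ge0// invf_le1// ler1n.
apply: self_similar_coind.
  by exists 1 => z [/andP[z0 z1] _]; rewrite ger0_norm.
move=> z [/andP[z0 z1] [x' [i [Ex' ik zE]]]] {x Ex}.
have [d dD Ey] := (self_similarP x').1 Ex'; set y := 3 * x' - d in Ey.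
have /andP[y0 y1] := self_similar_itv Ey.
case: i => [|i] in ik zE *.
  exists d => //; have -> : 3 * z - d = y.
    by case: zE => ->; rewrite expr0 /y; ring.
  by split; [exact/andP|exists y, 0%N; split=> //; left; rewrite expr0; ring].
move: zE; rewrite exprS; set e := 3^-1 ^+ i => zE.
have /andP[e0 e1] : 0 < e <= 1 by exact: e01.
have x'E : x' = (y + d) / 3 by rewrite /y; field.
case: zE => zE.
  exists 2; first exact: mem_digit2.
  move: dD; rewrite !inE => /or3P[] /eqP dE.
  - split; first by apply/andP; split; lra.
    exists y, i; split=> //; first exact: ltnW.
    by left; rewrite zE x'E dE -/e; field.
  - have /andP[f0 f1] := e01 k.
    (* The index is now [i + 1]. For [i > 0], [z <= 1] would give [lambda <= 3 ^- i <= 1/3], whereas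
       [lambda >= 2/3]. *)
    have : (i = 0)%N.
      case: i => // i in ik @e e0 e1 zE *; exfalso.
      have : 3^-1 ^+ i.+1 <= 3^-1 :> R.
        by rewrite exprS ler_piMr ?invr_ge0//; have /andP[] := e01 i.
      rewrite -/e.
      have : 3^-1 ^+ k <= 3^-1 :> R.
        by case: k k0 {lE ik f0 f1 K} => // k _; rewrite exprS ler_piMr ?invr_ge0//;
          have /andP[] := e01 k.
      by move: lE f0 z1 x'E dE; lra.
    move=> i0; have e1' : e = 1 by rewrite /e i0 expr0.
    split; first by apply/andP; split; lra.
    exists y, k; split=> //; left; move: lE zE x'E; rewrite dE e1'; lra.
  - by exfalso; lra.
exists 0; first exact: mem_digit0.
have dE : d = 2.
  by move: dD; rewrite !inE => /or3P[] /eqP dE //; exfalso; move: lambda_lt1; lra.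
split; first by apply/andP; split; lra.
exists y, i; split=> //; first exact: ltnW.
by right; rewrite zE x'E dE -/e; field.
Qed.

(** Peel off the first letter [d]: if [simil d u] is in [E] through a digit [d'], then
    [u = x + d' - d] with [x] in [E]. Both [u] and [x] are in [0, 1], so [d' - d] is 0 or [lambda]
    up to sign, and [self_similar_shift] applies. *)
Lemma tss_of_eq k : (0 < k)%N -> lambda = 1 - 3^-1 ^+ k ->
  totally_self_similar lambda.
Proof.
move=> k0 lE w wD; apply/seteqP; split.
  move=> z [x Ex <-]; split; last exact: self_similar_word.
  by exists x => //; rewrite /= in_itv /= self_similar_itv.
elim: w wD => [|d w IH] wD z [[t t01 <-] Ez]; first by exists t.
have dD : d \in digits lambda by apply: wD; rewrite mem_head.
have wD' : {subset w <= digits lambda} by move=> c cw; apply: wD; rewrite inE cw orbT.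
suff Ew : E (simil_word w t).
  have [|x Ex xE] := IH wD' (simil_word w t); first by split=> //; exists t.
  by exists x => //; exact: (congr1 (simil d) xE).
set u := simil_word w t in Ez *.
have u01 : 0 <= u <= 1.
  move: t01; rewrite /= in_itv /= /u => t01 {IH wD z Ez dD d u}.
  elim: w wD' => [|d w IH] wD //=.
  have /digits_itv/andP[d0 d2] : d \in digits lambda by apply: wD; rewrite mem_head.
  have /andP[h0 h1] : 0 <= simil_word w t <= 1.
    by apply: IH => c cw; apply: wD; rewrite inE cw orbT.
  rewrite /simil -/(simil_word w t); by apply/andP; split; lra.
have {}Ez : E (simil d u) by [].
have [d' d'D] := (self_similarP _).1 Ez.
have -> : 3 * simil d u - d' = u + d - d' by rewrite /simil; field.
set x := u + d - d' => Ex; have /andP[x0 x1] := self_similar_itv Ex.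
have [sh1 sh2] := self_similar_shift k0 lE Ex.
have uE : u = x + d' - d by rewrite /x; ring.
move: u01; rewrite uE => /andP[u0 u1].
move: dD d'D u0 u1 {uE}; rewrite !inE => /or3P[] /eqP -> /or3P[] /eqP ->;
  rewrite ?subr0 ?addr0 => u0 u1.
- by [].
- by apply: sh1; rewrite u0.
- by exfalso; lra.
- by apply: sh2; rewrite u0.
- by rewrite addrK.
- by exfalso; move: lambda_lt1; lra.
- by exfalso; lra.
- by exfalso; move: lambda_lt1; lra.
- by rewrite addrK.
Qed.

Lemma tss_iff_spectrum : spectrum lambda = 2 / 3 <-> totally_self_similar lambda.
Proof.
split=> [lE|]; last exact: tss_spectrum.
have [|k k0 kE] := spectrum_gt12; first by rewrite lE; lra.
exact: tss_of_eq kE.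
Qed.

Lemma not_tss_spectrum : ~ totally_self_similar lambda ->
  spectrum lambda <= Num.min lambda (1 / 2).
Proof.
move=> ntss; rewrite le_min (spectrum_le (spectrum_set_lambda lambda_gt0))/=.
by rewrite leNgt; apply/negP => /spectrum_gt12[k k0 kE]; apply/ntss/tss_of_eq/kE.
Qed.

End SelfSimilarSet.

(** * Arithmetic of the lattice spanned by an irrational [lambda] and 2 *)

Section IrrationalArithmetic.
Variables (R : realType) (lambda : R).
Hypothesis lambda_irr : irrational lambda.
Implicit Types (s t : seq R) (i j u v : int).

Lemma irrational_indep i j : lambda * i%:~R + 2 * j%:~R = 0 -> i = 0 /\ j = 0.
Proof.
have [-> | i0] := eqVneq i 0 => h; last first.
  exfalso; apply: lambda_irr; exists ((- 2 * j)%:~R / i%:~R) => //.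
  rewrite fmorph_div /= !ratr_int; apply: (canLR (mulfK _)).
    by rewrite intr_eq0.
  by rewrite rmorphM rmorphN /=; move: h; lra.
split=> //; move: h; rewrite mulr0 add0r => /eqP.
by rewrite mulf_eq0 intr_eq0 pnatr_eq0 /= => /eqP.
Qed.

Lemma base3_lattice s : {subset s <= digits lambda} ->
  exists i j, base3 s = lambda * i%:~R + 2 * j%:~R.
Proof.
elim: s => [|d s IH] sD; first by exists 0, 0; rewrite !mulr0 addr0.
have [|i [j sE]] := IH; first by move=> z zs; apply: sD; rewrite inE zs orbT.
have := sD d (mem_head _ _); rewrite /= sE !inE => /or3P[] /eqP ->.
- by exists (3 * i), (3 * j); rewrite !rmorphM /=; ring.
- by exists (1 + 3 * i), (3 * j); rewrite rmorphD !rmorphM /=; ring.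
- by exists (3 * i), (1 + 3 * j); rewrite rmorphD !rmorphM /=; ring.
Qed.

(** In the basis [lambda], 2 the digits are (0, 0), (1, 0) and (0, 1), which are distinct modulo 3;
    hence the lowest digits agree, and so on. *)
Lemma base3_inj s t : size s = size t -> {subset s <= digits lambda} ->
  {subset t <= digits lambda} -> base3 s = base3 t -> s = t.
Proof.
elim: s t => [|d s IH] [|e t]// [st] sD tD /= E.
have sD' : {subset s <= digits lambda} by move=> z zs; apply: sD; rewrite inE zs orbT.
have tD' : {subset t <= digits lambda} by move=> z zs; apply: tD; rewrite inE zs orbT.
suff de : d = e.
  by subst e; congr (_ :: _); apply: IH => //; move: E; lra.
have [i [j sE]] := base3_lattice sD'; have [i' [j' tE]] := base3_lattice tD'.
have key p q : (- 1 <= p <= 1)%Z -> (-1 <= q <= 1)%Z ->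
    d - e = lambda * p%:~R + 2 * q%:~R -> d = e.
  move=> p1 q1 deE.
  have [] := @irrational_indep (p + 3 * (i - i')) (q + 3 * (j - j')).
    rewrite !(rmorphD, rmorphM, rmorphB) /=.
    by move: E deE; rewrite sE tE; lra.
  move=> hp hq; have p0 : p = 0 by lia.
  have q0 : q = 0 by lia.
  by apply/eqP; rewrite -subr_eq0 deE p0 q0 !mulr0 addr0.
move: (sD d (mem_head _ _)) (tD e (mem_head _ _)) key {E IH}.
rewrite !inE => /or3P[] /eqP -> /or3P[] /eqP -> // key.
- by apply: (key (- 1) 0) => //; rewrite rmorphN /=; ring.
- by apply: (key 0 (- 1)) => //; rewrite rmorphN /=; ring.
- by apply: (key 1 0) => //=; ring.
- by apply: (key 1 (- 1)) => //; rewrite rmorphN /=; ring.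
- by apply: (key 0 1) => //=; ring.
- by apply: (key (- 1) 1) => //; rewrite rmorphN /=; ring.
Qed.

(** A Euclidean step: if [y] is not a multiple of [x], its remainder or the complement of the
    remainder is at most [x / 2]. By independence [lambda] and 2 are not both multiples of [x]. *)
Lemma lattice_halving i j : 0 < lambda * i%:~R + 2 * j%:~R ->
  exists u v, 0 < lambda * u%:~R + 2 * v%:~R <= (lambda * i%:~R + 2 * j%:~R) / 2.
Proof.
set x := lambda * _ + _ => x0.
have reduce (p q : int) : (forall n : int, lambda * p%:~R + 2 * q%:~R != n%:~R * x) ->
    exists u v, 0 < lambda * u%:~R + 2 * v%:~R <= x / 2.
  set y := lambda * _ + _ => yx; pose n := Num.floor (y / x).
  have h1 : n%:~R * x <= y by rewrite -ler_pdivlMr// floor_le.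
  have h2 : y < (n%:~R + 1) * x.
    by rewrite -ltr_pdivrMr//; have := floorD1_gt (y / x); rewrite rmorphD.
  have h3 : n%:~R * x < y by rewrite lt_neqAle h1 eq_sym yx.
  have [h|h] := leP (y - n%:~R * x) (x / 2).
    exists (p - n * i), (q - n * j).
    rewrite (_ : lambda * _ + _ = y - n%:~R * x); last first.
      by rewrite /x /y !(rmorphB, rmorphM) /=; ring.
    by rewrite h subr_gt0 h3.
  exists ((n + 1) * i - p), ((n + 1) * j - q).
  rewrite (_ : lambda * _ + _ = (n%:~R + 1) * x - y); last first.
    by rewrite /x /y !(rmorphB, rmorphM, rmorphD) /=; ring.
  by rewrite subr_gt0 h2 /=; move: h; lra.
have [h|/existsNP[n /negP]] := pselect (forall n : int, lambda * 1%:~R + 2 * 0%:~R != n%:~R * x).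
  exact: reduce h.
rewrite negbK => /eqP hn.
apply: (reduce 0 1) => m; apply/negP => /eqP hm.
have [] := @irrational_indep (1 - n * i) (- (n * j)).
  by rewrite !(rmorphB, rmorphN, rmorphM) /=; move: hn; rewrite /x; lra.
have [] := @irrational_indep (m * i) (m * j - 1).
  by rewrite !(rmorphB, rmorphN, rmorphM) /=; move: hm; rewrite /x; lra.
by nia.
Qed.

Lemma lattice_small (e : R) : 0 < e ->
  exists u v, 0 < lambda * u%:~R + 2 * v%:~R < e.
Proof.
move=> e0.
have small n : exists u v, 0 < lambda * u%:~R + 2 * v%:~R <= 2 / 2 ^+ n.
  elim: n => [|n [i [j /andP[x0 xn]]]]; first by exists 0, 1; rewrite expr0; lra.
  have [u [v /andP[y0 yx]]] := lattice_halving x0; exists u, v.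
  rewrite y0 /= (le_trans yx)// exprSr invfM mulrA ler_pM2r ?invr_gt0//.
have h : 0 <= 2 / e by rewrite divr_ge0// ltW.
have := archi_boundP h; set n := Num.bound _ => hn.
have [u [v /andP[x0 xn]]] := small n; exists u, v; rewrite x0 /=.
rewrite (le_lt_trans xn)// ltr_pdivrMr ?exprn_gt0// mulrC -ltr_pdivrMr//.
by rewrite (lt_le_trans hn)// -natrX ler_nat ltnW// ltn_expl.
Qed.

End IrrationalArithmetic.

(* Tilings of [int * int] by translates of the tromino
   {(0, 0), (1, 0), (0, 1)} are rigid. *)

Section Tromino.
Variable g : int -> int -> Prop.
Hypothesis cover : forall a b, g a b \/ g (a - 1) b \/ g a (b - 1).
Hypothesis excl1 : forall a b, g a b -> g (a - 1) b -> False.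
Hypothesis excl2 : forall a b, g a b -> g a (b - 1) -> False.
Hypothesis excl3 : forall a b, g (a - 1) b -> g a (b - 1) -> False.

(** Tiles are indexed by their corners; the three cases are, up to sign, the differences of corners
    of distinct overlapping tiles. *)
Let excl a b c d : g a b -> g c d ->
  [\/ c = a + 1 /\ d = b, c = a /\ d = b + 1 | c = a + 1 /\ d = b - 1] -> False.
Proof.
move=> h1 h2 [] [cE dE]; subst c d.
- by apply: (excl1 h2); rewrite addrK.
- by apply: (excl2 h2); rewrite addrK.
- by apply: (@excl3 (a + 1) b); rewrite ?addrK.
Qed.

(** Any other tile covering the cell in the notch of the tromino would overlap it. The next three
    lemmas test other cells in this way. *)
Lemma tromino_diag a b : g a b -> g (a + 1) (b + 1).
Proof.
move=> h; have [//|[h'|h']] := cover (a + 1) (b + 1); exfalso; apply: (excl h h').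
- by apply: Or32; rewrite addrK.
- by apply: Or31; rewrite addrK.
Qed.

Lemma tromino_diagN a b : g a b -> g (a - 1) (b - 1).
Proof.
move=> h; have [//|[h'|h']] := cover (a - 1) (b - 1); exfalso;
  apply: (excl (tromino_diag h') h).
- by apply: Or31; split; ring.
- by apply: Or32; split; ring.
Qed.

Lemma tromino_knight1 a b : g a b -> g (a + 2) (b - 1).
Proof.
move=> h; have [h'|[h'|//]] := cover (a + 2) b; last first.
  by exfalso; apply: (excl h h'); apply: Or31; split; ring.
exfalso; apply: (excl (tromino_diag h) h'); apply: Or33; split; ring.
Qed.

Lemma tromino_knight2 a b : g a b -> g (a - 1) (b + 2).
Proof.
move=> h; have [h'|[//|h']] := cover a (b + 2); last first.
  by exfalso; apply: (excl h h'); apply: Or32; split; ring.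
by exfalso; apply: (excl h' (tromino_diag h)); apply: Or33; split; ring.
Qed.

(** The periods are sums of the moves found: (3, 0) = (1, 1) + (2, -1) and (0, 3) = (1, 1) + (-1,
    2), and similarly for their opposites. *)
Lemma tromino_period a b u v : g a b -> g (a + 3 * u) (b + 3 * v).
Proof.
have iter (P : int -> Prop) : (forall c, P c -> P (c + 3) /\ P (c - 3)) ->
    forall c w, P c -> P (c + 3 * w).
  move=> PS c w Pc; elim: w => [|w IH|w IH]; first by rewrite mulr0 addr0.
    by rewrite (_ : _ + _ = c + 3 * w + 3); [case: (PS _ IH)|ring].
  by rewrite (_ : _ + _ = c + 3 * - w%:Z - 3); [case: (PS _ IH)|ring].
move=> h; apply: (iter (g (a + 3 * u))).
  move=> c h'; split.
    have := tromino_knight2 (tromino_diag h').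
    by rewrite addrK -addrA.
  have := tromino_knight1 (tromino_diagN (tromino_diagN h')).
  by congr (g _ _); ring.
apply: (iter (fun c => g c b)) => // c h'; split.
  have := tromino_knight1 (tromino_diag h').
  by rewrite addrK -addrA.
have := tromino_knight2 (tromino_diagN (tromino_diagN h')).
by congr (g _ _); ring.
Qed.

End Tromino.

(** * Limits of uniquely coded patches along an ultrafilter *)

Lemma ultra_setU T (F : set_system T) (A B : set T) :
  UltraFilter F -> F (A `|` B) -> F A \/ F B.
Proof.
move=> FU FAB; have [|FnA] := in_ultra_setVsetC A FU; first by left.
by right; apply: filterS (filterI FAB FnA) => x [[]].
Qed.

Section PatchLimit.
Variables (R : realType) (lambda l : R) (K : set R).
Hypothesis lambda_irr : irrational lambda.
Hypothesis l_gt0 : 0 < l.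
Hypothesis K01 : forall x, K x -> 0 <= x <= 1.
Hypothesis separated : forall s t : seq R, size s = size t ->
  {subset s <= digits lambda} -> {subset t <= digits lambda} -> s <> t ->
  l <= `|base3 s - base3 t|.

(** [s] lists the digits of the first [n] expansion steps of [x / 3 ^+ n], and [x - base3 s] is the
    point of [K] left over. *)
Definition coded n x (s : seq R) :=
  [/\ size s = n, {subset s <= digits lambda} & K (x - base3 s)].

Variables (n : nat -> nat) (y : nat -> R).
Hypothesis n_ge : forall N, (N <= n N)%N.
Hypothesis patch : forall N (a b : int), (`|a| <= N)%N -> (`|b| <= N)%N ->
  exists s, coded (n N) (y N + lambda * a%:~R + 2 * b%:~R) s /\
    forall t, coded (n N) (y N + lambda * a%:~R + 2 * b%:~R) t -> t = s.

Variable F : set_system nat.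
Hypothesis ultraF : UltraFilter F.
Hypothesis F_infty : \oo `<=` F.

Let point N (a b : int) := y N + lambda * a%:~R + 2 * b%:~R.

(* The code of [point N a b] has [k] zeros in its lowest positions. *)
Let low0 k a b N := exists s, [/\ (k + size s)%N = n N,
  {subset s <= digits lambda} & K (point N a b - 3 ^+ k * base3 s)].

(** Rigidity needs all of [int * int], while each patch is finite. The ultrafilter selects one digit
    for every cell simultaneously, so that the limit is a genuine tiling. *)
Let h k a b := F (low0 k a b).

Let base3_shift k (d : R) s : base3 (nseq k 0 ++ d :: s) = 3 ^+ k * (d + 3 * base3 s).
Proof. by elim: k => [|k IH] /=; rewrite ?expr0 ?mul1r// IH exprS; ring. Qed.

Let digit_code k a b d p q N :
  d \in digits lambda -> d * 3 ^+ k = lambda * (a - p)%:~R + 2 * (b - q)%:~R ->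
  low0 k.+1 p q N ->
  exists s, coded (n N) (point N a b) (nseq k 0 ++ d :: s).
Proof.
move=> dD dE [s [sn sD Ks]]; exists s; split.
- by rewrite size_cat size_nseq /= -sn addSnnS.
- move=> z; rewrite mem_cat => /orP[/nseqP[-> _]|]; first by rewrite inE eqxx.
  by rewrite inE => /predU1P[->//|/sD].
- rewrite base3_shift (_ : _ - _ = point N p q - 3 ^+ k.+1 * base3 s)//.
  move: dE; rewrite /point exprS !rmorphB /=; set u := 3 ^+ k; lra.
Qed.

Let inf_near (P : set nat) M : (forall N, (M <= N)%N -> P N) -> F P.
Proof. by move=> H; apply: F_infty; exists M. Qed.

Let p3 k : int := 3 ^+ k.

Let p3E k : (p3 k)%:~R = 3 ^+ k :> R. Proof. by rewrite rmorphXn. Qed.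

Let h0 a b : h 0 a b.
Proof.
apply: (@inf_near _ (maxn `|a| `|b|)) => N; rewrite geq_max => /andP[aN bN].
have [s [[sn sD Ks] _]] := patch aN bN; exists s; split=> //.
by rewrite expr0 mul1r.
Qed.

Let h_le k a b : h k.+1 a b -> h k a b.
Proof.
apply: filterS => N [s [sn sD Ks]]; exists (0 :: s); split.
- by rewrite /= -sn addSnnS.
- by move=> z; rewrite inE => /predU1P[->|/sD//]; exact: mem_digit0.
- by move: Ks; rewrite /= add0r exprSr mulrA.
Qed.

(** Removing the digit in position [k] moves the cell by 0 or by [p3 k] in one coordinate: these are
    the three ways to cover a cell by a tromino. *)
Let h_cover k a b : h k a b ->
  h k.+1 a b \/ h k.+1 (a - p3 k) b \/ h k.+1 a (b - p3 k).
Proof.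
move=> hk; suff : F (low0 k.+1 a b `|` (low0 k.+1 (a - p3 k) b `|` low0 k.+1 a (b - p3 k))).
  by move=> /(ultra_setU ultraF)[|/(ultra_setU ultraF)[]]; [left|right; left|right; right].
have Fk : F [set N | (k < N)%N] by exact: (@inf_near _ k.+1).
apply: filterS (filterI hk Fk) => N [[s [sn sD Ks]] /= kN].
case: s sn sD Ks => [|d s] sn sD Ks.
  by have := n_ge N; rewrite -sn addn0 leqNgt kN.
have sn' : (k.+1 + size s)%N = n N by rewrite -sn addSnnS.
have sD' : {subset s <= digits lambda} by move=> z zs; apply: sD; rewrite inE zs orbT.
have := sD d (mem_head _ _); rewrite !inE => /or3P[] /eqP dE; move: Ks; rewrite dE /= => Ks.
- left; exists s; split=> //.
  by move: Ks; rewrite add0r exprSr mulrA.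
- right; left; exists s; split=> //; move: Ks.
  by congr K; rewrite /point rmorphB /= p3E exprS; ring.
- right; right; exists s; split=> //; move: Ks.
  by congr K; rewrite /point rmorphB /= p3E exprS; ring.
Qed.

(** Two tiles over one cell would give it two codes that differ in position [k], against uniqueness
    once the patch contains the cell. *)
Let h_excl k a b d d' p q p' q' :
  d \in digits lambda -> d * 3 ^+ k = lambda * (a - p)%:~R + 2 * (b - q)%:~R ->
  d' \in digits lambda -> d' * 3 ^+ k = lambda * (a - p')%:~R + 2 * (b - q')%:~R ->
  d != d' -> h k.+1 p q -> h k.+1 p' q' -> False.
Proof.
move=> dD dE d'D d'E /eqP dd' hp hq.
have Fab : F [set N | (maxn `|a| `|b| <= N)%N].
  by apply: (@inf_near _ (maxn `|a| `|b|)) => N.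
have [N [[Np Nq]]] := filter_ex (filterI (filterI hp hq) Fab).
rewrite /= geq_max => /andP[aN bN]; have [r [_ ru]] := patch aN bN.
have [s /ru sE] := digit_code dD dE Np; have [t /ru tE] := digit_code d'D d'E Nq.
apply: dd'; have /(congr1 (fun z => nth 0 z k)) := etrans sE (esym tE).
by rewrite !nth_cat size_nseq ltnn subnn.
Qed.

(** By induction a whole coset of [p3 k] times [int * int] satisfies [h k]; the cells of [h k.+1]
    tile it by trominoes, and the tiling period 3 becomes [p3 k.+1]. *)
Let h_period k a b u v : h k a b -> h k (a + p3 k * u) (b + p3 k * v).
Proof.
have l0 : lambda != 0.
  by apply/eqP => l0; have [] := @irrational_indep _ _ lambda_irr 1 0;
    rewrite ?l0 ?mulr0 ?mul0r ?addr0.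
have l2 : lambda != 2.
  by apply/eqP => l2; have [] := @irrational_indep _ _ lambda_irr 1 (- 1);
    rewrite ?l2 ?rmorphN /= ?mulrN ?subrr.
elim: k a b u v => [|k IH] a b u v hk; first exact: h0.
have hk' i j : h k (a + p3 k * i) (b + p3 k * j) by exact/IH/h_le.
pose g i j := h k.+1 (a + p3 k * i) (b + p3 k * j).
have shift c i : c + p3 k * (i - 1) = c + p3 k * i - p3 k by ring.
have := @tromino_period g _ _ _ _ 0 0 u v; rewrite /g !mulr0 !addr0.
have -> : p3 k * (0 + 3 * u) = p3 k.+1 * u by rewrite add0r mulrA /p3 exprSr.
have -> : p3 k * (0 + 3 * v) = p3 k.+1 * v by rewrite add0r mulrA /p3 exprSr.
apply=> // i j; rewrite ?shift; set a' := a + _; set b' := b + _.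
- exact/h_cover/hk'.
- apply: (@h_excl k a' b' 0 lambda); rewrite ?mem_digit0 ?mem_digit1//.
  + by rewrite !subrr !mulr0 mul0r addr0.
  + by rewrite subKr subrr mulr0 addr0 p3E.
  + by rewrite eq_sym.
- apply: (@h_excl k a' b' 0 2); rewrite ?mem_digit0 ?mem_digit2//.
  + by rewrite !subrr !mulr0 mul0r addr0.
  + by rewrite subKr subrr mulr0 add0r p3E.
  + by rewrite eq_sym pnatr_eq0.
- apply: (@h_excl k a' b' lambda 2); rewrite ?mem_digit1 ?mem_digit2//.
  + by rewrite subKr subrr mulr0 addr0 p3E.
  + by rewrite subKr subrr mulr0 add0r p3E.
Qed.

Let h_ex k : exists a b, h k a b.
Proof.
elim: k => [|k [a [b /h_cover[|[]]]]]; first by exists 0, 0; exact: h0.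
- by exists a, b.
- by exists (a - p3 k), b.
- by exists a, (b - p3 k).
Qed.

Lemma no_patches : False.
Proof.
(* The period vector is chosen with [th < l / 2], and then [k] with [1 < 3 ^+ k * th]. *)
have [u [v /andP[th0 thl]]] := lattice_small lambda_irr (divr_gt0 l_gt0 (ltr0Sn R 1)).
set th := lambda * _ + _ in th0 thl.
have := archi_boundP (ltW (etrans (invr_gt0 _) th0)).
set k := Num.bound _ => hk.
have k3 : 1 < 3 ^+ k * th.
  rewrite -ltr_pdivrMr// div1r (lt_le_trans hk)//.
  by rewrite -natrX ler_nat ltnW// ltn_expl.
have [a [b hab]] := h_ex k; have hab' := h_period u v hab.
have [N [[s [sn sD Ks]] [t [tn tD Kt]]]] := filter_ex (filterI hab hab').
have {}sn : size s = size t by apply/(@addnI k); rewrite sn tn.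
set x := point N a b in Ks.
have xE : point N (a + p3 k * u) (b + p3 k * v) = x + 3 ^+ k * th.
  by rewrite /x /point /th !rmorphD !rmorphM /= p3E; ring.
rewrite xE in Kt; have /andP[s0 s1] := K01 Ks; have /andP[t0 t1] := K01 Kt.
(* Equal codes would leave two points of [0, 1] at distance [3 ^+ k * th > 1]. Distinct ones have
   values at distance at most [th + 3 ^- k < 2 * th < l]. *)
have st : s <> t by move=> st; subst t; move: s0 t1 k3; lra.
have := separated (esym sn) tD sD (not_eq_sym st).
have c0 : 0 < 3 ^+ k :> R by rewrite exprn_gt0.
rewrite -(ler_pM2l c0) -[X in X * `|_|]ger0_norm ?(ltW c0)// -normrM leNgt => /negP; apply.
have kl : 3 ^+ k * th < 3 ^+ k * (l / 2) by rewrite ltr_pM2l.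
by rewrite ltr_norml mulrBr; apply/andP; split; lra.
Qed.

End PatchLimit.

(** * Lebesgue measure under affine maps and small translations *)

Section AffineMeasure.
Variable R : realType.
Implicit Types (A B : set R) (r c : R).

Local Notation mu := (@lebesgue_measure R).

Lemma measurable_affine r c B : measurable B -> measurable [set x | B (r * x + c)].
Proof.
move=> mB; rewrite -[X in measurable X]setTI.
have mf : measurable_fun setT (fun x : R => r * x + c).
  by apply: measurable_funD => //; apply: measurable_funM.
exact: mf.
Qed.

(** By uniqueness of Lebesgue measure, it suffices to compare both sides on half-open intervals. *)
Lemma lebesgue_measure_affine r c B : 0 < r -> measurable B ->
  mu B = (r%:E * mu [set x | B (r * x + c)%R])%E.
Proof.
move=> r0 mB; pose f (x : measurableTypeR R) : measurableTypeR R := r * x + c.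
have mf : measurable_fun setT f.
  by apply: measurable_funD => //; apply: measurable_funM.
pose rn := NngNum (ltW r0).
rewrite (@lebesgue_measure_unique R (mscale rn (pushforward mu f)) _ B mB)//.
move=> _ [[a b]] _ <- /=; rewrite /mscale /= /pushforward.
rewrite (_ : f @^-1` _ = `](a - c) / r, (b - c) / r]%classic); last first.
  apply/seteqP; split=> x; rewrite /= /f !in_itv /= ltr_pdivrMr// ler_pdivlMr//;
    by rewrite (mulrC x) ltrBlDr lerBrDr.
rewrite !lebesgue_measure_itv /= !lte_fin ltr_pM2r ?invr_gt0// ltrBlDr subrK.
case: ifP => _; last by rewrite mule0.
by rewrite -!EFinD -EFinM; congr EFin; field; rewrite gt_eqF.
Qed.

Lemma avoid_small (I : eqType) (s : seq I) (F : I -> set R) A (e : R) : measurable A ->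
  (forall i, measurable (F i)) -> (forall i, i \in s -> mu (F i) <= e%:E)%E ->
  ((e *+ size s)%:E < mu A)%E -> exists2 x, A x & forall i, i \in s -> ~ F i x.
Proof.
move=> mA mF Fe sA; apply: contrapT => nx.
have mU : measurable (\big[setU/set0]_(i <- s) F i) by exact: bigsetU_measurable.
have : (mu A <= mu (\big[setU/set0]_(i <- s) F i))%E.
  apply: le_measure; rewrite ?inE// => x Ax; apply: contrapT => nU.
  apply: nx; exists x => // i; elim: s {Fe sA mU} nU => [//|j s IH].
  by rewrite big_cons => /not_orP[nj nU]; rewrite inE => /predU1P[->//|]; exact: IH.
apply/negP; rewrite -ltNge (le_lt_trans _ sA)// {nx sA mU}.
elim: s Fe => [|i s IH] Fe; first by rewrite big_nil measure0.
have {}IH : (mu (\big[setU/set0]_(j <- s) F j) <= (e *+ size s)%:E)%E.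
  by apply: IH => j js; apply: Fe; rewrite inE js orbT.
rewrite big_cons /= mulrS EFinD; apply: le_trans (leeD (Fe i (mem_head _ _)) IH).
by apply: measureU2; [exact: mF|apply: bigsetU_measurable => j _; exact: mF].
Qed.

Lemma negligible_affine r c B : 0 < r -> mu.-negligible B ->
  mu.-negligible [set x | B (r * x + c)].
Proof.
move=> r0 [N [mN N0 BN]]; exists [set x | N (r * x + c)]; split.
- exact: measurable_affine.
- have /esym/eqP := lebesgue_measure_affine c r0 mN; rewrite N0.
  by rewrite mule_eq0 eqe gt_eqF//= => /eqP.
- by move=> x /BN.
Qed.

(** Outer regularity provides an open [U]; compactness makes the radius [h] uniform over [K]. *)
Lemma compact_thickening (K : set R) (e : R) : compact K -> 0 < e ->
  exists U, [/\ measurable U, (mu (U `\` K) < e%:E)%E &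
    exists2 h : R, 0 < h & forall x d, K x -> `|d| < h -> U (x + d)].
Proof.
move=> cK e0; have mK := compact_measurable cK.
have Koo : (mu K < +oo)%E by exact: compact_finite_measure.
have [U [oU KU Ue]] := lebesgue_regularity_outer mK Koo e0.
exists U; split=> //; first exact: open_measurable.
have nc := (compact_near_coveringP K).1 cK _ (nbhs (0 : R)) (fun d x => U (x + d)).
have [x Kx|h /= h0 Kh] := nc.
  have c : (fun z : R * R => z.1 + z.2) @ (x, 0 : R) --> x + 0.
    exact: (@add_continuous R (x, 0)).
  by apply: c; apply: open_nbhs_nbhs; split=> //; rewrite addr0; exact: KU.
exists h => // x d Kx dh; apply: (Kh d) => //.
by rewrite /ball_ /= sub0r normrN.
Qed.

(** The translate and [K] have the same finite measure, so their two differences do too; the one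
    outside [K] lies in a thin [U] around [K]. *)
Lemma compact_translate (K : set R) (e : R) : compact K -> 0 < e ->
  exists2 h : R, 0 < h & forall d, `|d| < h -> (mu (K `\` [set x | K (x + d)]%R) <= e%:E)%E.
Proof.
move=> cK e0; have mK := compact_measurable cK.
have Koo : (mu K < +oo)%E by exact: compact_finite_measure.
have [U [mU Ue [h h0 Kh]]] := compact_thickening cK e0.
exists h => // d dh; set K' := [set x | _].
have K'E : K' = [set x | K (1 * x + d)] by apply/seteqP; split=> x; rewrite /K' /= mul1r.
have mK' : measurable K' by rewrite K'E; exact: measurable_affine.
have muK' : mu K' = mu K by rewrite (lebesgue_measure_affine d ltr01 mK) mul1e K'E.
have -> : mu (K `\` K') = mu (K' `\` K).
  have K'oo : (mu K' < +oo)%E by rewrite muK'.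
  rewrite measureD// [RHS]measureD//.
  by rewrite (setIC K'); congr (_ - _)%E; exact: esym muK'.
rewrite (le_trans _ (ltW Ue))// le_measure ?inE//; try exact: measurableD.
move=> x [K'x nKx]; split=> //; rewrite -(addrK d x); apply: Kh => //.
by rewrite normrN.
Qed.

End AffineMeasure.

(** * Codes read from the highest digit *)

Section Coding.
Variables (R : realType) (lambda : R) (K : set R).
Implicit Types (s t : seq R) (x d : R).

Lemma base3_rcons s d : base3 (rcons s d) = base3 s + 3 ^+ size s * d.
Proof.
by elim: s => [|c s IH] /=; rewrite ?IH ?expr0 ?mulr0 ?addr0 ?add0r ?mul1r// exprS; ring.
Qed.

Lemma coded0 x s : coded lambda K 0 x s <-> s = [::] /\ K x.
Proof.
split=> [[/size0nil -> _]|[-> Kx]]; first by rewrite subr0.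
by split=> //=; rewrite subr0.
Qed.

Lemma coded_rcons n x s : coded lambda K n.+1 (3 ^+ n.+1 * x) s <->
  exists t d, [/\ s = rcons t d, d \in digits lambda &
    coded lambda K n (3 ^+ n * (3 * x - d)) t].
Proof.
have E t d : size t = n ->
    3 ^+ n.+1 * x - base3 (rcons t d) = 3 ^+ n * (3 * x - d) - base3 t.
  by move=> tn; rewrite base3_rcons tn exprSr; ring.
split=> [[]|[t [d [-> dD [tn tD Kt]]]]].
  case/lastP: s => [//|t d]; rewrite size_rcons => -[tn] sD; rewrite E// => Kt.
  exists t, d; split=> //; first by apply: sD; rewrite mem_rcons mem_head.
  by split=> // z zt; apply: sD; rewrite mem_rcons inE zt orbT.
split; rewrite ?size_rcons ?tn ?E//.
by move=> z; rewrite mem_rcons inE => /predU1P[->|/tD].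
Qed.

End Coding.

(** * Measure of overlaps and of multiply coded points *)

Section Fibres.
Variables (R : realType) (lambda : R).
Implicit Types (A B : set R) (n : nat) (s t : seq R) (x y d e : R).

Local Notation mu := (@lebesgue_measure R).

(** This is the image of [B] under [simil d], written as a preimage for the sake of
    measurability. *)
Definition piece d B : set R := [set x | B (3 * x - d)].

Definition pieces B := piece 0 B `|` (piece lambda B `|` piece 2 B).

Lemma piecesP B x : pieces B x <-> exists2 d, d \in digits lambda & piece d B x.
Proof.
split=> [[|[]] h|[d]]; [exists 0|exists lambda|exists 2|];
  rewrite ?mem_digit0 ?mem_digit1 ?mem_digit2//.
by rewrite !inE => /or3P[] /eqP -> ?; [left|right; left|right; right].
Qed.

Lemma measurable_piece d B : measurable B -> measurable (piece d B).
Proof. exact: measurable_affine. Qed.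

Lemma measurable_pieces B : measurable B -> measurable (pieces B).
Proof. by move=> mB; do 2?apply: measurableU; exact: measurable_piece. Qed.

Lemma piece_measure d B : measurable B -> mu (piece d B) = (3^-1%:E * mu B)%E.
Proof.
move=> mB; rewrite (@lebesgue_measure_affine R 3 (- d) B)// muleA -EFinM.
by rewrite mulVf// mul1e.
Qed.

Definition multiple B n : set R := [set x | exists s t,
  [/\ s <> t, coded lambda B n (3 ^+ n * x) s & coded lambda B n (3 ^+ n * x) t]].

Definition coverage B n : set R := [set x | exists s, coded lambda B n (3 ^+ n * x) s].

Lemma coverage0 B : coverage B 0 = B.
Proof.
apply/seteqP; split=> x; rewrite /coverage /= expr0 mul1r.
  by move=> [s /coded0[]].
by exists [::]; apply/coded0.
Qed.

Lemma coverageS B n : coverage B n.+1 = pieces (coverage B n).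
Proof.
apply/seteqP; split=> x.
  move=> [s /coded_rcons[t [d [_ dD tc]]]]; apply/piecesP; exists d => //.
  by exists t.
move=> /piecesP[d dD [t tc]]; exists (rcons t d); apply/coded_rcons.
by exists t, d.
Qed.

Lemma measurable_coverage B n : measurable B -> measurable (coverage B n).
Proof.
move=> mB; elim: n => [|n IH]; first by rewrite coverage0.
by rewrite coverageS; exact: measurable_pieces.
Qed.

Lemma pieces_measure B : measurable B ->
  piece 0 B `&` piece lambda B = set0 -> piece 0 B `&` piece 2 B = set0 ->
  piece lambda B `&` piece 2 B = set0 -> mu (pieces B) = mu B.
Proof.
move=> mB h01 h02 h12; have m d := measurable_piece d mB.
have m12 : measurable (piece lambda B `|` piece 2 B).
  by apply: measurableU; exact: m.
have -> : mu (pieces B) =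
    (mu (piece 0%R B) + (mu (piece lambda B) + mu (piece 2 B)))%E.
  have d0 : piece 0 B `&` (piece lambda B `|` piece 2 B) = set0.
    by rewrite setIUr h01 h02 setU0.
  apply: (etrans (measureU mu (m 0) m12 d0)); congr (_ + _)%E.
  exact: (measureU mu (m lambda) (m 2) h12).
have c : (0 <= 3^-1%:E :> \bar R)%E by rewrite lee_fin.
rewrite !piece_measure// -!ge0_muleDl ?adde_ge0// -!EFinD.
by rewrite [X in X%:E](_ : _ = 1) ?mul1e//; field.
Qed.

(** Three sets of measure [mu B / 3] whose union has measure [mu B] leave no room for an overlap. *)
Lemma pieces_overlap B d e f : measurable B -> (mu B < +oo)%E ->
  mu (pieces B) = mu B -> pieces B `<=` (piece d B `|` piece e B) `|` piece f B ->
  mu (piece d B `&` piece e B) = 0.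
Proof.
move=> mB Boo BE sub; have m c := measurable_piece c mB.
have finB : mu B \is a fin_num by rewrite ge0_fin_numE.
have poo c : (mu (piece c B) < +oo)%E by rewrite piece_measure// -(fineK finB) -EFinM ltry.
have mde : measurable (piece d B `|` piece e B) by exact: measurableU.
have mI : measurable (piece d B `&` piece e B) by exact: measurableI.
have : (mu B <= mu (piece d B `|` piece e B) + mu (piece f B))%E.
  rewrite -BE; apply: (le_trans _ (measureU2 mu mde (m f))).
  apply: le_measure => //; rewrite inE; first exact: measurable_pieces.
  exact: measurableU mde (m f).
have -> : mu (piece d B `|` piece e B) =
  (mu (piece d B) + mu (piece e B) - mu (piece d B `&` piece e B))%E.
  exact: (@measureUfinr _ _ _ mu _ _ (m d) (m e) (poo e)).
move=> h.
have finI : mu (piece d B `&` piece e B) \is a fin_num.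
  rewrite ge0_fin_numE//; apply: le_lt_trans (poo e).
  apply: le_measure => //; by [rewrite inE; exact: m|rewrite inE|move=> x []].
move: h; rewrite !piece_measure// -(fineK finB) -(fineK finI) -!EFinM -!EFinD lee_fin => h.
apply/eqP; rewrite eqe eq_le fine_ge0// andbT; lra.
Qed.

(** Two codes either differ in the top digit, and the point lies in two pieces of [B], or share it,
    and the expanded point has two shorter codes. *)
Lemma multiple_negligible B n : (forall x, B x <-> pieces B x) ->
  mu.-negligible (piece 0 B `&` piece lambda B) ->
  mu.-negligible (piece 0 B `&` piece 2 B) ->
  mu.-negligible (piece lambda B `&` piece 2 B) -> mu.-negligible (multiple B n).
Proof.
move=> BE n01 n02 n12.
have Bcode m x s : coded lambda B m (3 ^+ m * x) s -> B x.
  elim: m x s => [|m IH] x s; first by rewrite expr0 mul1r => /coded0[].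
  move=> /coded_rcons[t [d [_ dD /IH Bx]]]; apply/BE/piecesP.
  by exists d.
elim: n => [|n IH].
  rewrite (_ : multiple B 0 = set0); first exact: negligible_set0.
  by apply/seteqP; split=> // x [s [t [st /coded0[sE _] /coded0[tE _]]]]; case: st; rewrite sE tE.
have sub : multiple B n.+1 `<=` pieces (multiple B n) `|`
    ((piece 0 B `&` piece lambda B) `|` ((piece 0 B `&` piece 2 B) `|`
     (piece lambda B `&` piece 2 B))).
  move=> x [s [t [st /coded_rcons[s' [d [sE dD sc]]] /coded_rcons[t' [e [tE eD tc]]]]]].
  have [de|de] := eqVneq d e.
    left; apply/piecesP; exists d => //; exists s', t'; split=> //.
      by move=> st'; apply: st; rewrite sE tE st' de.
    by rewrite de.
  right; have {}sc := Bcode _ _ _ sc; have {}tc := Bcode _ _ _ tc.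
  move: dD eD de sc tc {sE tE}; rewrite !inE => /or3P[] /eqP -> /or3P[] /eqP ->;
    rewrite ?eqxx// => _ sc tc; by
    [left; split|right; left; split|right; right; split].
apply: (@negligibleS _ _ _ mu _ _ sub); apply: negligibleU; last by do 2?apply: negligibleU.
by do 2?apply: negligibleU; exact: negligible_affine.
Qed.

End Fibres.

(** * Positive measure of the attractor and existence of uniquely coded patches *)

Section IrrationalParameter.
Variables (R : realType) (lambda : R).
Hypotheses (lambda_gt0 : 0 < lambda) (lambda_lt1 : lambda < 1).

Local Notation E := (self_similar_set lambda).
Local Notation mu := (@lebesgue_measure R).

Let E_compact : compact E. Proof. exact: self_similar_compact. Qed.

Let E_pieces x : E x <-> pieces lambda E x.
Proof. by rewrite piecesP; exact: self_similarP. Qed.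

Let E_coded n x : E x -> exists s, coded lambda E n (3 ^+ n * x) s.
Proof.
elim: n x => [|n IH] x Ex; first by exists [::]; apply/coded0; rewrite expr0 mul1r.
have [d dD /IH[t tc]] := (self_similarP lambda_gt0 lambda_lt1 x).1 Ex.
by exists (rcons t d); apply/coded_rcons; exists t, d.
Qed.

Variable l : R.
Hypothesis l_gt0 : 0 < l.
Hypothesis separated : forall s t : seq R, size s = size t ->
  {subset s <= digits lambda} -> {subset t <= digits lambda} -> s <> t ->
  l <= `|base3 s - base3 t|.

(** Translates of this half-open interval by [l]-separated values are disjoint, so its iterated
    images keep the total measure [l]. *)
Let J : set R := `[0, l[%classic.

Let J_disjoint n d e : d \in digits lambda -> e \in digits lambda -> d != e ->
  piece d (coverage lambda J n) `&` piece e (coverage lambda J n) = set0.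
Proof.
move=> dD eD de; apply/seteqP; split=> // x [[s sc] [t tc]].
have [ss sD Js] := (coded_rcons lambda J n x (rcons s d)).2
  (ex_intro _ s (ex_intro _ d (And3 erefl dD sc))).
have [st tD Jt] := (coded_rcons lambda J n x (rcons t e)).2
  (ex_intro _ t (ex_intro _ e (And3 erefl eD tc))).
have := @separated (rcons s d) (rcons t e) (etrans ss (esym st)) sD tD.
move: Js Jt; rewrite /J /= !in_itv /= => /andP[a1 a2] /andP[b1 b2] h.
have : l <= `|base3 (rcons s d) - base3 (rcons t e)|.
  by apply: h => /rcons_inj[_ /eqP]; exact/negP.
by rewrite leNgt ltr_norml => /negP; apply; apply/andP; split; lra.
Qed.

Let J_measure n : mu (coverage lambda J n) = l%:E.
Proof.
have mJ : measurable J by exact: measurable_itv.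
have z2 : 0 != 2 :> R by rewrite eq_sym pnatr_eq0.
elim: n => [|n IH].
  by rewrite coverage0 lebesgue_measure_itv /= lte_fin l_gt0 oppr0 adde0.
rewrite coverageS pieces_measure//; first exact: measurable_coverage;
  apply: J_disjoint; rewrite ?mem_digit0 ?mem_digit1 ?mem_digit2// lt_eqF//.
by rewrite (lt_trans lambda_lt1)// ltr1n.
Qed.

Let pow_large (a : R) : exists n, forall m, (n <= m)%N -> a < 3 ^+ m.
Proof.
exists (Num.bound `|a|) => m nm; rewrite (le_lt_trans (ler_norm a))//.
rewrite (lt_le_trans (archi_boundP (normr_ge0 a)))// -natrX ler_nat.
by rewrite (leq_trans nm)// ltnW// ltn_expl.
Qed.

(** The [n]-th iterated image of [J] has measure [l] and lies within [l / 3 ^+ n] of [E], hence in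
    any thickening of [E] for large [n]. *)
Lemma separated_measure : (l%:E <= mu E)%E.
Proof.
have mE := compact_measurable E_compact.
apply/lee_addgt0Pr => e e0.
have [U [mU Ue [h h0 EU]]] := compact_thickening E_compact e0.
have [n /(_ n (leqnn n)) nh] := pow_large (l / h).
have p0 : 0 < 3 ^+ n :> R by rewrite exprn_gt0.
have sub : coverage lambda J n `<=` U.
  move=> x [s [sn sD]]; rewrite /J /= in_itv /= => /andP[h1 h2].
  have -> : x = base3 s / 3 ^+ n + (x - base3 s / 3 ^+ n) by ring.
  apply: EU.
    have := self_similar_word lambda_gt0 lambda_lt1 (w := rev s) _
      (self_similar0 lambda_gt0 lambda_lt1).
    by rewrite simil_word_rev add0r sn; apply=> z; rewrite mem_rev => /sD.
  have -> : x - base3 s / 3 ^+ n = (3 ^+ n * x - base3 s) / 3 ^+ n.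
    by field; rewrite gt_eqF.
  rewrite ger0_norm ?divr_ge0 ?(ltW p0)// ltr_pdivrMr//.
  by rewrite (lt_trans h2)// mulrC -ltr_pdivrMr.
rewrite -(J_measure n).
have mJ : measurable (coverage lambda J n).
  by apply: measurable_coverage; exact: measurable_itv.
have h1 : (mu (coverage lambda J n) <= mu U)%E by apply: le_measure; rewrite ?inE.
have h2 : (mu U <= mu (U `\` E) + mu E)%E.
  have mD : measurable (U `\` E) by exact: measurableD.
  apply: le_trans (measureU2 mu mD mE); apply: le_measure; rewrite ?inE//.
    exact: measurableU.
  by move=> x Ux; have [Ex|nEx] := pselect (E x); [right|left].
apply: (le_trans h1); apply: (le_trans h2); rewrite addeC; apply: leeD => //.
exact: ltW.
Qed.

Lemma multiple_null n : mu.-negligible (multiple lambda E n).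
Proof.
have mE := compact_measurable E_compact.
have Eoo : (mu E < +oo)%E by exact: compact_finite_measure.
have EE : mu (pieces lambda E) = mu E.
  by congr mu; apply/seteqP; split=> x /E_pieces.
have null d e f : pieces lambda E `<=` (piece d E `|` piece e E) `|` piece f E ->
    mu.-negligible (piece d E `&` piece e E).
  move=> sub; exists (piece d E `&` piece e E); split=> //.
    by apply: measurableI; exact: measurable_piece.
  exact: (pieces_overlap mE Eoo EE sub).
apply: multiple_negligible => //.
- by apply: (@null _ _ 2) => x [|[]] ?; [left; left|left; right|right].
- by apply: (@null _ _ lambda) => x [|[]] ?; [left; left|right|left; right].
- by apply: (@null _ _ 0) => x [|[]] ?; [right|left; left|left; right].
Qed.

(** Scaled by [3 ^- n], the window becomes finitely many tiny translations. Each carries all but a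
    small part of [E] into uniquely coded points of [E], so some [x] in [E] is good for all of
    them. *)
Lemma coded_patch N : exists n y, (N <= n)%N /\
  forall a b : int, (`|a| <= N)%N -> (`|b| <= N)%N ->
  exists s, coded lambda E n (y + lambda * a%:~R + 2 * b%:~R) s /\
    forall t, coded lambda E n (y + lambda * a%:~R + 2 * b%:~R) t -> t = s.
Proof.
have mE := compact_measurable E_compact.
pose r : seq int := [seq k%:Z - N%:Z | k <- iota 0 (N + N).+1].
have rP (a : int) : (`|a| <= N)%N -> a \in r.
  move=> aN; apply/mapP; exists (absz (a + N%:Z)); last by lia.
  by rewrite mem_iota; lia.
have rN (a : int) : a \in r -> (`|a| <= N)%N.
  by move=> /mapP[k]; rewrite mem_iota => + ->; lia.
pose I := [seq (a, b) | a <- r, b <- r].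
(* The successor makes the total loss [size I * e] strictly less than [l], hence less than
   [mu E]. *)
pose e := l / (size I).+1%:R.
have e0 : 0 < e by rewrite divr_gt0.
have [h h0 Eh] := compact_translate E_compact e0.
(* Window displacements are at most [3 * N] in absolute value, so [n] makes every [delta] smaller
   than [h]. *)
have [n0 n0P] := pow_large (3 * N.+1%:R / h).
pose n := maxn N n0; have {n0P} nh := n0P n (leq_maxr _ _).
have p0 : 0 < 3 ^+ n :> R by rewrite exprn_gt0.
have [Z [mZ Z0 MZ]] := multiple_null n.
pose delta (ab : int * int) : R := (lambda * ab.1%:~R + 2 * ab.2%:~R) / 3 ^+ n.
have dh ab : ab \in I -> `|delta ab| < h.
  move=> /allpairsP[[a b] [/= /rN aN /rN bN ->]].
  rewrite /delta /= normrM normfV (gtr0_norm p0) ltr_pdivrMr//.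
  rewrite (mulrC h) -ltr_pdivrMr// (le_lt_trans _ nh)// ler_pM2r ?invr_gt0//.
  rewrite (le_trans (ler_normD _ _))// !normrM (gtr0_norm lambda_gt0).
  rewrite (ger0_norm (ler0n _ 2)) -!intr_norm -!natr_absz.
  have ha : (`|a|%N%:R : R) <= N%:R by rewrite ler_nat.
  have hb : (`|b|%N%:R : R) <= N%:R by rewrite ler_nat.
  have : lambda * (`|a|%N%:R : R) <= `|a|%N%:R by rewrite ler_piMl// ltW.
  by rewrite -[N.+1%:R]natr1; lra.
(* The bad [x] for the cell [ab]: its translate leaves [E], or falls into the null set [Z] of
   multiply coded points. *)
pose F ab := (E `\` [set x | E (x + delta ab)]) `|` [set x | Z (1 * x + delta ab)].
have mE' d : measurable [set x | E (x + d)].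
  rewrite (_ : [set x | _] = [set x | E (1 * x + d)]); first exact: measurable_affine.
  by apply/seteqP; split=> x /=; rewrite mul1r.
have mD ab : measurable (E `\` [set x | E (x + delta ab)]) by exact: measurableD.
have mZ' ab : measurable [set x | Z (1 * x + delta ab)] by exact: measurable_affine.
have mF ab : measurable (F ab) by exact: measurableU.
have Fe ab : ab \in I -> (mu (F ab) <= e%:E)%E.
  move=> abI; have ZD : mu [set x | Z (1 * x + delta ab)] = 0.
    by have := lebesgue_measure_affine (delta ab) ltr01 mZ; rewrite Z0 mul1e.
  have : (mu (E `\` [set x | E (x + delta ab)%R]) +
      mu [set x | Z (1 * x + delta ab)%R] <= e%:E)%E.
    by rewrite ZD adde0; exact/Eh/dh.
  exact: le_trans (measureU2 mu (mD ab) (mZ' ab)).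
have small : ((e *+ size I)%:E < mu E)%E.
  apply: lt_le_trans separated_measure; rewrite lte_fin /e -mulr_natr mulrAC.
  by rewrite ltr_pdivrMr// ltr_pM2l// ltr_nat.
have [x Ex xF] := avoid_small mE mF Fe small.
exists n, (3 ^+ n * x); split=> [|a b aN bN]; first exact: leq_maxl.
have abI : (a, b) \in I by apply/allpairsP; exists (a, b); split=> //; exact: rP.
have -> : 3 ^+ n * x + lambda * a%:~R + 2 * b%:~R = 3 ^+ n * (x + delta (a, b)).
  by rewrite /delta /=; field; rewrite gt_eqF.
have /not_orP[nE nZ] := xF _ abI.
have Ex' : E (x + delta (a, b)) by apply: contrapT => nEx; apply: nE.
have [s sc] := E_coded n Ex'; exists s; split=> // t tc.
apply: contrapT => ts; apply: nZ; rewrite /= mul1r; apply: MZ.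
by exists t, s.
Qed.

End IrrationalParameter.

(** A positive spectrum would separate the values of distinct codes, by [base3_inj]; this yields
    patches of every size, which [no_patches] forbids. *)
Lemma irrational_spectrum (R : realType) (lambda : R) : 0 < lambda -> lambda < 1 ->
  irrational lambda -> spectrum lambda = 0.
Proof.
move=> l0 l1 lirr; apply/eqP; rewrite eq_le spectrum_ge0// andbT leNgt.
apply/negP => s0.
have sep (s t : seq R) : size s = size t -> {subset s <= digits lambda} ->
    {subset t <= digits lambda} -> s <> t -> spectrum lambda <= `|base3 s - base3 t|.
  move=> st sD tD nst; have [u uD uE] := base3_sub st sD tD.
  apply/spectrum_le/spectrum_set_abs; first by exists u.
  by rewrite subr_eq0; apply/eqP => /(base3_inj lirr st sD tD).
have [n /choice[y ny]] := choice (coded_patch l0 l1 s0 sep).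
have [F [FU Foo]] := @ultraFilterLemma nat \oo _.
apply: (@no_patches R lambda (spectrum lambda) (self_similar_set lambda) lirr s0
  _ sep n y _ _ F FU Foo).
- by move=> x; exact: self_similar_itv.
- by move=> N; case: (ny N).
- by move=> N; case: (ny N).
Qed.

Theorem theorem2 (R : realType) (lambda : R)
  (lambda_gt0 : 0 < lambda) (lambda_lt1 : lambda < 1) :
  (spectrum lambda = 0 <-> irrational lambda) /\
  ((spectrum lambda = 2 / 3 <-> totally_self_similar lambda) /\
   (~ totally_self_similar lambda ->
      0 <= spectrum lambda /\ spectrum lambda <= Num.min lambda (1 / 2))) /\
  ((rational lambda -> spectrum_computable lambda) /\
   (forall m n q : nat,
      m = 1%N \/ m = 2%N -> (0 < q)%N -> coprime (m * 3 ^ n) q ->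
      lambda = (m * 3 ^ n)%:R / q%:R ->
      spectrum lambda = m%:R / q%:R)).
Proof.
split; last split.
- split=> [s0 lQ|]; last exact: irrational_spectrum.
  by have := rational_spectrum_gt0 lambda_gt0 lQ; rewrite s0 ltxx.
- split; first exact: tss_iff_spectrum.
  by move=> ntss; split; [exact: spectrum_ge0|exact: not_tss_spectrum].
- by split; [exact: rational_computable|exact: spectrum_rational_value].
Qed.
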